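(* Let $f : \mathbb{R}^{N\times N} \to \mathbb{R}$ be differentiable with $\|\nabla f(X') - \nabla f(X'')\|_F \leq M_1 \|X' - X''\|_F$ for all $X', X'' \in \mathcal{O}(N)$, for some $M_1 > 0$. Let $\widetilde f : \mathbb{R}^{N\times N}\to\mathbb{R}$ be a random differentiable function such that $\mathbb{E}\,\nabla \widetilde f(X) = \nabla f(X)$ and $\mathbb{E}\,\|\nabla \widetilde f(X)\|_F^2 \leq M_2$ for all $X \in \mathcal{O}(N)$, for some $M_2>0$; at each iteration below an independent copy of $\widetilde f$ is drawn. Let $v^{(0,1)}, \dots, v^{(0,L)} \in \mathbb{R}^N$ be deterministic nonzero vectors and for $k > 0$, $1 \le l \le L$ define $$v^{(k,l)} = v^{(k-1,l)} - k^{-1/2}\, \nabla_{v^{(k-1,l)}} \widetilde f\big(H(v^{(k-1,1)}) \cdots H(v^{(k-1,L)})\big).$$ Then all $v^{(k,l)}$ are well-defined (nonzero), and for every $\epsilon > 0$, $$\min_{0 \le k' < K} \sum_{l=1}^L \mathbb{E}\,\Big\|\nabla_{v^{(k',l)}} f\big(H(v^{(k',1)}) \cdots H(v^{(k',L)})\big)\Big\|_2^2 = o\big(K^{-1/2+\epsilon}\big) \quad (K\to\infty).$$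
   Context: $\mathcal{O}(N) = \{Q \in \mathbb{R}^{N\times N} : Q^\top Q = I\}$; $\|\cdot\|_F$ is the Frobenius norm. For nonzero $v\in\mathbb{R}^N$, $H(v) = I - 2vv^\top/\|v\|_2^2$. The notation $\nabla_{v^{(l)}} g(H(v^{(1)})\cdots H(v^{(L)}))$ denotes the gradient with respect to $v^{(l)}\in\mathbb{R}^N$ of the composite function $(v^{(1)},\dots,v^{(L)}) \mapsto g(H(v^{(1)})\cdots H(v^{(L)}))$. *)

(* Defs.v *)
From HB Require Import structures.
From mathcomp Require Import all_boot all_order all_algebra.
From mathcomp Require Import all_classical all_reals all_analysis.
Set Implicit Arguments. Unset Strict Implicit. Unset Printing Implicit Defensive.
Import Order.TTheory GRing.Theory Num.Theory.
Import numFieldNormedType.Exports.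
Local Open Scope classical_set_scope.
Local Open Scope ring_scope.

Section Defs.
Variable R : realType.

Definition frob2 m n (A : 'M[R]_(m, n)) : R := \sum_i \sum_j A i j ^+ 2.
Definition frob m n (A : 'M[R]_(m, n)) : R := Num.sqrt (frob2 A).

Definition mxO N (Q : 'M[R]_N) : Prop := Q^T *m Q = 1%:M.

Definition grad m n (F : 'M[R]_(m, n) -> R) (X : 'M[R]_(m, n)) : 'M[R]_(m, n) :=
  \matrix_(i, j) ('d F X (delta_mx i j)).

Definition householder N (v : 'cV[R]_N) : 'M[R]_N :=
  1%:M - (2 / frob2 v) *: (v *m v^T).

Definition prodH N L (vs : 'I_L -> 'cV[R]_N) : 'M[R]_N :=
  foldr (fun l M => householder (vs l) *m M) 1%:M (enum 'I_L).

Definition upd N L (vs : 'I_L -> 'cV[R]_N) (l : 'I_L) (v : 'cV[R]_N) :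
  'I_L -> 'cV[R]_N := fun l' => if l' == l then v else vs l'.

Definition gradv N L (g : 'M[R]_N -> R) (vs : 'I_L -> 'cV[R]_N) (l : 'I_L) :
  'cV[R]_N := grad (fun v => g (prodH (upd vs l v))) (vs l).

(* the SGD iterates: iterate gt v0 k = (v^(k,l))_l, where gt k is the k-th
   independent copy of the random function (used to go from step k to k+1) *)
Fixpoint iterate N L (gt : nat -> 'M[R]_N -> R) (v0 : 'I_L -> 'cV[R]_N)
  (k : nat) : 'I_L -> 'cV[R]_N :=
  match k with
  | 0 => v0
  | k'.+1 => fun l => iterate gt v0 k' l
      - (Num.sqrt (k'.+1)%:R)^-1 *: gradv (gt k') (iterate gt v0 k') l
  end.

End Defs.

Definition mxBorel (R : realType) m n := g_sigma_algebraType (@open 'M[R]_(m, n)).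

Local Open Scope ereal_scope.
Definition mutually_independent (R : realType) d d' (Omega : measurableType d)
  (P : probability Omega R) (Xi : measurableType d') (xi : nat -> Omega -> Xi) :=
  forall (s : seq nat) (A : nat -> set Xi), uniq s ->
    (forall i, i \in s -> measurable (A i)) ->
    P (\bigcap_(i in [set` s]) (xi i @^-1` A i)) =
    \prod_(i <- s) P (xi i @^-1` A i).

(* Main.v *)
Require Import Defs.
From HB Require Import structures.
From mathcomp Require Import all_boot all_order all_algebra.
From mathcomp Require Import all_classical all_reals all_analysis.
From mathcomp Require Import measurable_realfun.
From mathcomp Require Import ring lra.
Import Order.TTheory GRing.Theory Num.Theory.
Import numFieldNormedType.Exports.
Local Open Scope classical_set_scope.
Local Open Scope ring_scope.

(** Householder matrices do not see the length of their vector, so the gradient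
    with respect to [v_l] is orthogonal to [v_l].  A gradient step therefore never
    shortens [v_l], and the whole segment from [v_l] to its update stays at
    distance at least [|v_l|] from the origin.  Along this segment the product of
    Householder matrices stays orthogonal, where [grad f] is Lipschitz, and its
    derivative is Lipschitz with a constant controlled by the initial lengths.
    This gives the descent inequality
    [f(Q_(k+1)) <= f(Q_k) - eta_k <grad F, grad F~> + C eta_k^2 |grad f~(Q_k)|^2].
    The [k]-th sample is independent of the sigma-algebra generated by the
    previous ones, so Fubini turns the expected cross term into the mean squared
    gradient.  Summing with [eta_k = 1 / sqrt (k+1)], the left-over is
    [O(1 + ln K)], whereas [sum_(k<K) eta_k >= sqrt K]. *)

Set Implicit Arguments.
Unset Strict Implicit.
Unset Printing Implicit Defensive.

(** * Frobenius inner product and norm *)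

Section Frobenius.
Variable R : realType.

(** The gradient of [f] is controlled on orthogonal matrices only, and the chord between two such
    matrices leaves that set; hence the comparison path is the image of a segment in the space of
    vectors. The gradient of a sample is controlled only through its mean and mean square at a fixed
    orthogonal matrix, so all second-order constants must come from [f], from the Householder map
    and from the lower bound on the lengths; they are the same for every outcome and every step. The
    gradient in the vectors is the adjoint of the derivative [dprodH] of the product. The cross term
    thus becomes <grad f~(Q_k), U_k> with U_k = [dprodH v_k (gradv f v_k)]: linear in the sample,
    with a coefficient fixed by the past, which is the form to which unbiasedness applies.
    Orthogonal matrices form a bounded set; this bounds [grad f] through the Lipschitz condition and
    [f] itself by compactness, so the expectations are finite and the telescoping sum stays
    bounded. *)

Definition mxdot m n (A B : 'M[R]_(m, n)) : R := \sum_i \sum_j A i j * B i j.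

Lemma mxdotC m n (A B : 'M[R]_(m, n)) : mxdot A B = mxdot B A.
Proof. by apply: eq_bigr => i _; apply: eq_bigr => j _; rewrite mulrC. Qed.

Lemma mxdotDl m n (A B C : 'M[R]_(m, n)) : mxdot (A + B) C = mxdot A C + mxdot B C.
Proof.
rewrite /mxdot -big_split; apply: eq_bigr => i _ /=; rewrite -big_split.
by apply: eq_bigr => j _ /=; rewrite mxE mulrDl.
Qed.

Lemma mxdotZl m n a (A B : 'M[R]_(m, n)) : mxdot (a *: A) B = a * mxdot A B.
Proof.
rewrite /mxdot mulr_sumr; apply: eq_bigr => i _; rewrite mulr_sumr.
by apply: eq_bigr => j _; rewrite mxE mulrA.
Qed.

Lemma mxdotDr m n (A B C : 'M[R]_(m, n)) : mxdot A (B + C) = mxdot A B + mxdot A C.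
Proof. by rewrite mxdotC mxdotDl !(mxdotC A). Qed.

Lemma mxdotZr m n a (A B : 'M[R]_(m, n)) : mxdot A (a *: B) = a * mxdot A B.
Proof. by rewrite mxdotC mxdotZl mxdotC. Qed.

Lemma mxdotNr m n (A B : 'M[R]_(m, n)) : mxdot A (- B) = - mxdot A B.
Proof. by rewrite -scaleN1r mxdotZr mulN1r. Qed.

Lemma mxdotNl m n (A B : 'M[R]_(m, n)) : mxdot (- A) B = - mxdot A B.
Proof. by rewrite mxdotC mxdotNr mxdotC. Qed.

Lemma mxdot0r m n (A : 'M[R]_(m, n)) : mxdot A 0 = 0.
Proof. by rewrite -[X in mxdot _ X](scale0r 0) mxdotZr mul0r. Qed.

Lemma mxdot_sumr (I : Type) (s : seq I) m n (A : 'M[R]_(m, n)) (B : I -> 'M[R]_(m, n)) :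
  mxdot A (\sum_(i <- s) B i) = \sum_(i <- s) mxdot A (B i).
Proof. by apply: (big_morph (mxdot A)) => [x y|]; rewrite ?mxdotDr ?mxdot0r. Qed.

Lemma mxdotxx m n (A : 'M[R]_(m, n)) : mxdot A A = frob2 A.
Proof. by apply: eq_bigr => i _; apply: eq_bigr => j _; rewrite expr2. Qed.

Lemma mxdot_trace m n (A B : 'M[R]_(m, n)) : mxdot A B = \tr (A^T *m B).
Proof.
rewrite /mxdot exchange_big /=; apply: eq_bigr => j _; rewrite mxE.
by apply: eq_bigr => i _; rewrite mxE.
Qed.

Lemma mxdot_cVE n (u v : 'cV[R]_n) : mxdot u v = \sum_i u i 0 * v i 0.
Proof. by apply: eq_bigr => i _; rewrite big_ord1. Qed.

Lemma mxdot_delta m n (A : 'M[R]_(m, n)) i j : mxdot A (delta_mx i j) = A i j.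
Proof.
rewrite /mxdot (bigD1 i)//= (bigD1 j)//= mxE !eqxx mulr1.
rewrite big1 => [|k /negPf nk]; last by rewrite mxE nk andbF mulr0.
rewrite addr0 big1 ?addr0// => k /negPf nk.
by apply: big1 => l _; rewrite mxE nk mulr0.
Qed.

Lemma frob2_ge0 m n (A : 'M[R]_(m, n)) : 0 <= frob2 A.
Proof. by apply: sumr_ge0 => i _; apply: sumr_ge0 => j _; rewrite sqr_ge0. Qed.

Lemma frob_ge0 m n (A : 'M[R]_(m, n)) : 0 <= frob A.
Proof. exact: sqrtr_ge0. Qed.

Lemma sqr_frob m n (A : 'M[R]_(m, n)) : frob A ^+ 2 = frob2 A.
Proof. by rewrite sqr_sqrtr// frob2_ge0. Qed.

Lemma frob2_eq0 m n (A : 'M[R]_(m, n)) : (frob2 A == 0) = (A == 0).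
Proof.
apply/eqP/eqP => [A0|->]; last first.
  by apply: big1 => i _; apply: big1 => j _; rewrite mxE expr0n.
apply/matrixP => i j; rewrite mxE.
have sq0 k l : 0 <= A k l ^+ 2 by rewrite sqr_ge0.
have s0 k : 0 <= \sum_l A k l ^+ 2 by apply: sumr_ge0.
have r0 : forall k, true -> \sum_l A k l ^+ 2 = 0 by exact: psumr_eq0P.
have e0 : forall l, true -> A i l ^+ 2 = 0 by apply: psumr_eq0P => //; exact: r0.
by have /eqP := e0 j isT; rewrite sqrf_eq0 => /eqP.
Qed.

Lemma frob2_gt0 m n (A : 'M[R]_(m, n)) : (0 < frob2 A) = (A != 0).
Proof. by rewrite lt_def frob2_ge0 andbT frob2_eq0. Qed.

Lemma frob_gt0 m n (A : 'M[R]_(m, n)) : (0 < frob A) = (A != 0).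
Proof. by rewrite sqrtr_gt0 frob2_gt0. Qed.

Lemma le_frob m n p q (A : 'M[R]_(m, n)) (B : 'M[R]_(p, q)) :
  frob2 A <= frob2 B -> frob A <= frob B.
Proof. by move=> h; rewrite ler_wsqrtr. Qed.

Lemma frobN m n (A : 'M[R]_(m, n)) : frob (- A) = frob A.
Proof. by rewrite /frob -!mxdotxx mxdotNl mxdotNr opprK. Qed.

Lemma frobZ m n a (A : 'M[R]_(m, n)) : frob (a *: A) = `|a| * frob A.
Proof.
by rewrite /frob -!mxdotxx mxdotZl mxdotZr mulrA -expr2 sqrtrM ?sqr_ge0// sqrtr_sqr.
Qed.

Lemma cauchy_schwarz (I : finType) (a b : I -> R) :
  (\sum_i a i * b i) ^+ 2 <= (\sum_i a i ^+ 2) * (\sum_i b i ^+ 2).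
Proof.
set A := \sum_i a i ^+ 2; set B := \sum_i b i ^+ 2; set c := \sum_i _.
have A0 : 0 <= A by apply: sumr_ge0 => i _; exact: sqr_ge0.
have [A00|An0] := eqVneq A 0.
  have a0 i : a i = 0.
    have e0 : forall k, true -> a k ^+ 2 = 0.
      by apply: psumr_eq0P => // k _; exact: sqr_ge0.
    by have /eqP := e0 i isT; rewrite sqrf_eq0 => /eqP.
  by rewrite /c big1 ?expr0n ?A00 ?mul0r// => i _; rewrite a0 mul0r.
(* With the weights [A] and [c] the expansion collapses to [A * (A * B - c ^+ 2)]. *)
have H : 0 <= \sum_i (A * b i - c * a i) ^+ 2 by apply: sumr_ge0 => i _; exact: sqr_ge0.
have HE (x y : R) : \sum_i (x * b i - y * a i) ^+ 2 = x ^+ 2 * (\sum_i b i ^+ 2)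
    - 2 * x * y * (\sum_i a i * b i) + y ^+ 2 * (\sum_i a i ^+ 2).
  rewrite !mulr_sumr -sumrB -big_split; apply: eq_bigr => i _ /=.
  by rewrite sqrrB !exprMn; ring.
have {}H : 0 <= A * (A * B - c ^+ 2).
  by move: H; rewrite HE -/A -/B -/c; congr (_ <= _); ring.
by rewrite pmulr_rge0 ?subr_ge0 // lt_def An0 in H.
Qed.

Lemma mxdot_sqr_le m n (A B : 'M[R]_(m, n)) : mxdot A B ^+ 2 <= frob2 A * frob2 B.
Proof.
rewrite /mxdot /frob2 !pair_bigA /=.
exact: (cauchy_schwarz (fun p => A p.1 p.2) (fun p => B p.1 p.2)).
Qed.

Lemma normr_mxdot_le m n (A B : 'M[R]_(m, n)) : `|mxdot A B| <= frob A * frob B.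
Proof.
rewrite -(ler_pXn2r (_ : 0 < 2)%N) ?nnegrE ?mulr_ge0 ?frob_ge0//.
by rewrite exprMn !sqr_frob -normrX ger0_norm ?sqr_ge0// mxdot_sqr_le.
Qed.

Lemma mxdot_le m n (A B : 'M[R]_(m, n)) : mxdot A B <= frob A * frob B.
Proof. by rewrite (le_trans (ler_norm _))// normr_mxdot_le. Qed.

Lemma frobD m n (A B : 'M[R]_(m, n)) : frob (A + B) <= frob A + frob B.
Proof.
rewrite -(ler_pXn2r (_ : 0 < 2)%N) ?nnegrE ?addr_ge0 ?frob_ge0//.
rewrite sqr_frob -mxdotxx mxdotDl !mxdotDr (mxdotC B A) !mxdotxx sqrrD !sqr_frob.
by have := mxdot_le A B; lra.
Qed.

Lemma frobB m n (A B : 'M[R]_(m, n)) : frob (A - B) <= frob A + frob B.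
Proof. by rewrite (le_trans (frobD _ _))// frobN. Qed.

Lemma frobM m n p (A : 'M[R]_(m, n)) (B : 'M[R]_(n, p)) :
  frob (A *m B) <= frob A * frob B.
Proof.
rewrite -(ler_pXn2r (_ : 0 < 2)%N) ?nnegrE ?mulr_ge0 ?frob_ge0//.
rewrite exprMn !sqr_frob /frob2 mulr_suml; apply: ler_sum => i _.
rewrite [X in _ <= _ * X]exchange_big mulr_sumr; apply: ler_sum => j _.
by rewrite mxE; exact: cauchy_schwarz.
Qed.

Lemma frob_mulmx_tr m n (u : 'cV[R]_m) (v : 'cV[R]_n) :
  frob (u *m v^T) = frob u * frob v.
Proof.
rewrite /frob -sqrtrM ?frob2_ge0//; congr Num.sqrt.
rewrite /frob2 mulr_suml; apply: eq_bigr => i _; rewrite big_ord1 mulr_sumr.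
by apply: eq_bigr => j _; rewrite !big_ord1 mxE big_ord1 mxE exprMn.
Qed.

Lemma normr_entry_le m n (A : 'M[R]_(m, n)) i j : `|A i j| <= frob A.
Proof.
rewrite -sqrtr_sqr ler_wsqrtr// /frob2 (bigD1 i)//= (bigD1 j)//= -addrA lerDl.
rewrite addr_ge0//; first by apply: sumr_ge0 => k _; exact: sqr_ge0.
by apply: sumr_ge0 => k _; apply: sumr_ge0 => l _; exact: sqr_ge0.
Qed.

(** With [frobM] alone, each orthogonal factor would cost its norm, the square root of [N]; exact
    invariance keeps the bounds on products linear in the number of factors. *)
Lemma frob_mul_mxOl N p (Q : 'M[R]_N) (A : 'M[R]_(N, p)) :
  mxO Q -> frob (Q *m A) = frob A.
Proof.
by move=> QO; rewrite /frob -!mxdotxx !mxdot_trace trmx_mul mulmxA -(mulmxA A^T) QO mulmx1.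
Qed.

Lemma frob_mul_mxOr N p (Q : 'M[R]_N) (A : 'M[R]_(p, N)) :
  mxO Q -> frob (A *m Q) = frob A.
Proof.
move=> QO; rewrite /frob -!mxdotxx !mxdot_trace trmx_mul -mulmxA mxtrace_mulC.
by rewrite -!mulmxA (mulmx1C QO) mulmx1.
Qed.

Lemma mxO1 N : mxO (1%:M : 'M[R]_N).
Proof. by rewrite /mxO trmx1 mulmx1. Qed.

Lemma mxO_mul N (P Q : 'M[R]_N) : mxO P -> mxO Q -> mxO (P *m Q).
Proof. by move=> PO QO; rewrite /mxO trmx_mul mulmxA -(mulmxA Q^T) PO mulmx1. Qed.

Lemma frob_mxO N (Q : 'M[R]_N) : mxO Q -> frob Q = frob (1%:M : 'M[R]_N).
Proof. by move=> QO; rewrite -[Q in LHS]mulmx1 frob_mul_mxOl. Qed.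

Lemma mxdot_diff m n (A A' B B' : 'M[R]_(m, n)) :
  mxdot A' B' - mxdot A B = mxdot (A' - A) B' + mxdot A (B' - B).
Proof. by rewrite mxdotDl mxdotNl mxdotDr mxdotNr addrA subrK. Qed.

Lemma mulmx_diff m n p (A A' : 'M[R]_(m, n)) (B B' : 'M[R]_(n, p)) :
  A' *m B' - A *m B = (A' - A) *m B' + A *m (B' - B).
Proof. by rewrite mulmxBl mulmxBr addrA subrK. Qed.

Lemma trmx_mul_cV N (u v : 'cV[R]_N) : u^T *m v = (mxdot u v)%:M.
Proof.
apply/matrixP => i j; rewrite !ord1 !mxE mxdot_cVE eqxx mulr1n.
by apply: eq_bigr => k _; rewrite mxE.
Qed.

End Frobenius.

(** * Derivative of a product of Householder matrices *)

Section MatrixDifferential.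
Variable R : realType.

Lemma grad_mxdot m n (F : 'M[R]_(m, n) -> R) X D : 'd F X D = mxdot (grad F X) D.
Proof.
rewrite [D in LHS]matrix_sum_delta linear_sum; apply: eq_bigr => i _.
rewrite linear_sum; apply: eq_bigr => j _.
by rewrite linearZ /= mxE mulrC.
Qed.

Variable V : normedModType R.
Implicit Types x : V.

Lemma is_diff_sum (W : normedModType R) (I : Type) (s : seq I) (f df : I -> V -> W) x :
  (forall i, is_diff x (f i) (df i)) ->
  is_diff x (fun y => \sum_(i <- s) f i y) (fun y => \sum_(i <- s) df i y).
Proof.
move=> fdf; elim: s => [|i s IHs].
  rewrite (_ : (fun y => _) = cst 0); last by apply/funext => y; rewrite big_nil.
  rewrite (_ : (fun y => _) = 0); last by apply/funext => y; rewrite big_nil.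
  exact: is_diff_cst.
rewrite (_ : (fun y => _) = f i + (fun y => \sum_(i <- s) f i y)); last first.
  by apply/funext => y; rewrite big_cons.
apply: is_diff_eq.
by apply/funext => y; rewrite big_cons.
Qed.

Lemma is_diffZl (W : normedModType R) (k dk : V -> R) (A : W) x :
  is_diff x k dk -> is_diff x (fun y => k y *: A) (fun y => dk y *: A).
Proof.
move=> kdk; have dkx : differentiable k x by exact: ex_diff.
apply: DiffDef; first exact: differentiableZl.
by rewrite diffZl//; apply/funext => y; rewrite diff_val.
Qed.

(** Decomposing over the matrices [delta_mx i j] reduces matrix-valued derivatives to scalar ones,
    to which the scalar product rule applies. *)
Lemma is_diff_mx m n (M dM : V -> 'M[R]_(m, n)) x :
  (forall i j, is_diff x (fun y => M y i j) (fun y => dM y i j)) -> is_diff x M dM.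
Proof.
move=> H.
rewrite (_ : M = (fun y => \sum_i \sum_j M y i j *: delta_mx i j)); last first.
  by apply/funext => y; rewrite -matrix_sum_delta.
rewrite (_ : dM = (fun y => \sum_i \sum_j dM y i j *: delta_mx i j)); last first.
  by apply/funext => y; rewrite -matrix_sum_delta.
by apply: is_diff_sum => i; apply: is_diff_sum => j; exact: is_diffZl.
Qed.

Lemma is_diff_entry m n (M dM : V -> 'M[R]_(m, n)) x i j :
  is_diff x M dM -> is_diff x (fun y => M y i j) (fun y => dM y i j).
Proof.
move=> MdM; pose c : 'M[R]_(m, n) -> R := fun A => A i j.
have cc : is_diff (M x) c c.
  apply: DiffDef; first exact: differentiable_coord.
  have @f : {linear 'M[R]_(m, n) -> R}.
    by exists c; do 2![eexists]; do ?[constructor]; rewrite /c ?mxE// => ? *;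
       rewrite ?mxE//; move=> ?; rewrite !mxE.
  by rewrite -[c]/(f : _ -> _) diff_lin//; exact: coord_continuous.
exact: (is_diff_comp MdM cc).
Qed.

Lemma is_diff_mulmx m n p (A dA : V -> 'M[R]_(m, n)) (B dB : V -> 'M[R]_(n, p)) x :
  is_diff x A dA -> is_diff x B dB ->
  is_diff x (fun y => A y *m B y) (fun y => dA y *m B x + A x *m dB y).
Proof.
move=> AdA BdB; apply: is_diff_mx => i j.
rewrite (_ : (fun y => _) = (fun y => \sum_k A y i k * B y k j)); last first.
  by apply/funext => y; rewrite mxE.
rewrite [X in is_diff _ _ X](_ : _ =
  (fun y => \sum_k (A x i k * dB y k j + dA y i k * B x k j))); last first.
  by apply/funext => y; rewrite !mxE -big_split; apply: eq_bigr => k _ /=; exact: addrC.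
apply: is_diff_sum => k.
have dAe : is_diff x (fun y => A y i k) (fun y => dA y i k) by exact: is_diff_entry.
have dBe : is_diff x (fun y => B y k j) (fun y => dB y k j) by exact: is_diff_entry.
apply: (is_diff_eq (is_diffM dAe dBe)).
by apply/funext => y; rewrite !fctE; congr (_ + _); rewrite [RHS]mulrC.
Qed.

End MatrixDifferential.

Section Householder.
Variable R : realType.

(** Derivative of [householder] at [v] in the direction [d]: the first term differentiates the
    factor 1/|v|^2, the second the matrix v v^T. *)
Definition dhouseholder N (v d : 'cV[R]_N) : 'M[R]_N :=
  (4 * mxdot v d / frob2 v ^+ 2) *: (v *m v^T)
  - (2 / frob2 v) *: (d *m v^T + v *m d^T).

Lemma householderE N (v : 'cV[R]_N) i j :
  householder v i j = (i == j)%:R - 2 / frob2 v * (v i 0 * v j 0).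
Proof. by rewrite /householder !mxE big_ord1 mxE. Qed.

Lemma dhouseholderE N (v d : 'cV[R]_N) i j : dhouseholder v d i j =
  4 * mxdot v d / frob2 v ^+ 2 * (v i 0 * v j 0)
  - 2 / frob2 v * (d i 0 * v j 0 + v i 0 * d j 0).
Proof. by rewrite /dhouseholder !mxE !big_ord1 !mxE. Qed.

Lemma is_diff_frob2 (V : normedModType R) N (W dW : V -> 'cV[R]_N) x :
  is_diff x W dW ->
  is_diff x (fun y => frob2 (W y)) (fun y => 2 * mxdot (W x) (dW y)).
Proof.
move=> WdW; have We i : is_diff x (fun y => W y i 0) (fun y => dW y i 0).
  exact: is_diff_entry.
rewrite (_ : (fun y => _) = (fun y => \sum_i W y i 0 * W y i 0)); last first.
  by apply/funext => y; rewrite -mxdotxx mxdot_cVE.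
rewrite [X in is_diff _ _ X](_ : _ = (fun y => \sum_i 2 * (W x i 0 * dW y i 0))); last first.
  by apply/funext => y; rewrite mxdot_cVE mulr_sumr.
apply: is_diff_sum => i; apply: (is_diff_eq (is_diffM (We i) (We i))).
by apply/funext => y; rewrite !fctE /GRing.scale /=; ring.
Qed.

Lemma is_diff_householder (V : normedModType R) N (W dW : V -> 'cV[R]_N) x :
  is_diff x W dW -> W x != 0 ->
  is_diff x (fun y => householder (W y)) (fun y => dhouseholder (W x) (dW y)).
Proof.
move=> WdW Wx0; have We i : is_diff x (fun y => W y i 0) (fun y => dW y i 0).
  exact: is_diff_entry.
have F0 : frob2 (W x) != 0 by rewrite frob2_eq0.
have dF := is_diff_frob2 WdW.
have dV : is_diff x (fun y => (frob2 (W y))^-1)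
    (fun y => - (frob2 (W x)) ^- 2 * (2 * mxdot (W x) (dW y))).
  have dFx : differentiable (fun y => frob2 (W y)) x by exact: ex_diff.
  apply: DiffDef; first exact: differentiableV.
  rewrite (diffV dFx F0).
  by apply/funext => y; rewrite diff_val.
apply: is_diff_mx => i j; pose e : R := (i == j)%:R.
rewrite (_ : (fun y => _) = cst e -
   cst (2 : R) * ((fun y => (frob2 (W y))^-1) * ((fun y => W y i 0) * (fun y => W y j 0)))); last first.
  by apply/funext => y; rewrite !fctE householderE -mulrA.
have d1 : is_diff x (cst e) (fun=> 0) by exact: is_diff_cst.
have d2 : is_diff x (cst (2 : R)) (fun=> 0) by exact: is_diff_cst.
apply: (is_diff_eq (is_diffB d1 (is_diffM d2 (is_diffM dV (is_diffM (We i) (We j)))))).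
apply/funext => y; rewrite dhouseholderE !fctE /GRing.scale /=.
field; exact: F0.
Qed.

(** Since (v v^T)(v v^T) = |v|^2 v v^T, the quadratic term 4/|v|^2 v v^T of the square cancels the
    two linear ones. *)
Lemma mxO_householder N (v : 'cV[R]_N) : v != 0 -> mxO (householder v).
Proof.
rewrite -frob2_eq0 => v0; rewrite /mxO /householder.
have -> : (1%:M - (2 / frob2 v) *: (v *m v^T))^T = 1%:M - (2 / frob2 v) *: (v *m v^T).
  by rewrite raddfB /= trmx1 linearZ /= trmx_mul trmxK.
rewrite mulmxBl mul1mx -scalemxAl mulmxBr mulmx1 -scalemxAr.
rewrite mulmxA -(mulmxA v) trmx_mul_cV mxdotxx mul_mx_scalar -!scalemxAl.
apply/matrixP => i j; rewrite !mxE.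
set s := \sum_(_ < 1) _.
field; exact: v0.
Qed.

Section Product.
Variables N L : nat.
Implicit Types (vs ds : 'I_L -> 'cV[R]_N) (s : seq 'I_L).

(** [prodH] is the case [enum 'I_L]; inductions need arbitrary lists of indices. *)
Definition prodHs vs s : 'M[R]_N := foldr (fun l M => householder (vs l) *m M) 1%:M s.

Fixpoint dprodHs vs ds s : 'M[R]_N :=
  if s is l :: s' then
    dhouseholder (vs l) (ds l) *m prodHs vs s' + householder (vs l) *m dprodHs vs ds s'
  else 0.

Definition dprodH vs ds := dprodHs vs ds (enum 'I_L).

Lemma mxO_prodHs vs s : (forall l, vs l != 0) -> mxO (prodHs vs s).
Proof.
move=> vs0; elim: s => [|l s IHs]; first exact: mxO1.
by apply: mxO_mul => //; exact: mxO_householder.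
Qed.

Lemma mxO_prodH vs : (forall l, vs l != 0) -> mxO (prodH vs).
Proof. exact: mxO_prodHs. Qed.

Lemma dhouseholderD (v d e : 'cV[R]_N) :
  dhouseholder v (d + e) = dhouseholder v d + dhouseholder v e.
Proof.
apply/matrixP => i j.
by rewrite [RHS]mxE !dhouseholderE mxdotDr !mxE; ring.
Qed.

Lemma dhouseholderZ a (v d : 'cV[R]_N) : dhouseholder v (a *: d) = a *: dhouseholder v d.
Proof.
apply/matrixP => i j.
by rewrite [RHS]mxE !dhouseholderE mxdotZr !mxE; ring.
Qed.

(** Euler's relation: [householder] is homogeneous of degree 0. *)
Lemma dhouseholderxx (v : 'cV[R]_N) : v != 0 -> dhouseholder v v = 0.
Proof.
rewrite -frob2_eq0 => v0; apply/matrixP => i j.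
rewrite dhouseholderE mxdotxx mxE; field; exact: v0.
Qed.

Lemma dprodHD vs ds es :
  dprodH vs (fun l => ds l + es l) = dprodH vs ds + dprodH vs es.
Proof.
rewrite /dprodH; elim: (enum _) => [|l s IHs] /=; first by rewrite addr0.
by rewrite IHs dhouseholderD mulmxDl mulmxDr addrACA.
Qed.

Lemma dprodHZ a vs ds : dprodH vs (fun l => a *: ds l) = a *: dprodH vs ds.
Proof.
rewrite /dprodH; elim: (enum _) => [|l s IHs] /=; first by rewrite scaler0.
by rewrite IHs dhouseholderZ -scalemxAl -scalemxAr scalerDr.
Qed.

Lemma dprodH0 vs ds : (forall l, dhouseholder (vs l) (ds l) = 0) -> dprodH vs ds = 0.
Proof.
move=> h; rewrite /dprodH; elim: (enum _) => [|l s IHs] //=.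
by rewrite IHs h mul0mx mulmx0 addr0.
Qed.

(** The parameter space [V] is left free: it is the space of one vector when computing [gradv], and
    the real line when moving along a segment. *)
Lemma is_diff_prodH (V : normedModType R) (W dW : V -> 'I_L -> 'cV[R]_N) x :
  (forall l, is_diff x (W ^~ l) (dW ^~ l)) -> (forall l, W x l != 0) ->
  is_diff x (fun y => prodH (W y)) (fun y => dprodH (W x) (dW y)).
Proof.
move=> dWl W0.
rewrite /prodH /dprodH; elim: (enum _) => [|l s IHs] /=.
  by apply: (is_diff_eq (is_diff_cst 1%:M x)).
exact: (is_diff_mulmx (is_diff_householder (dWl l) (W0 l)) IHs).
Qed.

Definition single (l : 'I_L) (d : 'cV[R]_N) : 'I_L -> 'cV[R]_N :=
  fun l' => if l' == l then d else 0.

Lemma sum_single ds : ds = (fun l' => \sum_l single l (ds l) l').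
Proof.
apply/funext => l'; rewrite (bigD1 l')//= /single eqxx big1 ?addr0// => l.
by rewrite eq_sym => /negPf ->.
Qed.

Lemma dprodH_sum_single vs ds : dprodH vs ds = \sum_l dprodH vs (single l (ds l)).
Proof.
rewrite [ds in LHS]sum_single.
elim: (index_enum _) => [|l r IHr].
  rewrite big_nil; apply: dprodH0 => l; rewrite big_nil.
  by rewrite -(scale0r 0) dhouseholderZ scale0r.
rewrite big_cons -IHr -dprodHD; congr dprodH.
by apply/funext => l'; rewrite big_cons.
Qed.

Lemma upd_id vs l : upd vs l (vs l) = vs.
Proof. by apply/funext => l'; rewrite /upd; case: eqP => // ->. Qed.

(** Chain rule: [gradv g vs l] is the image of [grad g] at the product under the adjoint of the
    derivative of the product in its [l]-th vector. *)
Lemma mxdot_gradv (g : 'M[R]_N -> R) vs l d :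
  (forall X, differentiable g X) -> (forall l, vs l != 0) ->
  mxdot (gradv g vs l) d = mxdot (grad g (prodH vs)) (dprodH vs (single l d)).
Proof.
move=> dg vs0; rewrite -!grad_mxdot.
have dU l' : is_diff (vs l) (fun v => upd vs l v l') (fun v => single l v l').
  rewrite /upd /single; case: (l' == l).
  - exact: is_diff_id.
  - exact: is_diff_cst.
have := @is_diff_prodH _ (upd vs l) (single l) (vs l) dU.
rewrite upd_id => /(_ vs0) dP.
have dgP : is_diff (prodH (upd vs l (vs l))) g ('d g (prodH vs)).
  by rewrite upd_id; exact: differentiableP.
exact: (congr1 (fun h => h d) (@diff_val _ _ _ _ _ _ _ (is_diff_comp dP dgP))).
Qed.

Lemma mxdot_gradv_sum (g : 'M[R]_N -> R) vs ds :
  (forall X, differentiable g X) -> (forall l, vs l != 0) ->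
  \sum_l mxdot (gradv g vs l) (ds l) = mxdot (grad g (prodH vs)) (dprodH vs ds).
Proof.
move=> dg vs0; rewrite dprodH_sum_single mxdot_sumr.
by apply: eq_bigr => l _; exact: mxdot_gradv.
Qed.

(* Householder matrices are invariant under scaling of the vector, so the gradient is tangent to the sphere. *)
Lemma mxdot_gradv_orth (g : 'M[R]_N -> R) vs l :
  (forall X, differentiable g X) -> (forall l, vs l != 0) ->
  mxdot (gradv g vs l) (vs l) = 0.
Proof.
move=> dg vs0; rewrite mxdot_gradv// dprodH0 ?mxdot0r// => l'.
rewrite /single; case: eqP => [->|_]; first exact: dhouseholderxx.
by rewrite -(scale0r 0) dhouseholderZ scale0r.
Qed.

End Product.
End Householder.

(** * Descent along a segment *)

Section ScalarBounds.
Variables (R : realFieldType) (x y t : R).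
Hypotheses (x0 : 0 < x) (y0 : 0 <= y) (t0 : 0 <= t) (t1 : t <= 1).
(** By Pythagoras, [s] is |v + t d|^2 when [v] and [d] are orthogonal of norms [x] and [y]. *)
Let s := x ^+ 2 + t ^+ 2 * y ^+ 2.

Let s_gt0 : 0 < s.
Proof. by rewrite ltr_wpDr ?(sqr_ge0, mulr_ge0) ?exprn_gt0. Qed.

Let xx_le_s : x ^+ 2 <= s.
Proof. by rewrite lerDl mulr_ge0 ?sqr_ge0. Qed.

Let xy_le_s : 2 * (t * (x * y)) <= s.
Proof. by have := sqr_ge0 (x - t * y); rewrite /s; nra. Qed.

(** The summands are the absolute coefficients of v v^T, d v^T + v d^T and d d^T in H(v + t d) -
    H(v), times bounds on the norms of these matrices. The constant is 6 = 2 + 4: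
    [4 * t ^+ 2 * y * x] is at most [2 * s] since 2 t x y <= s, and [4 * t * x ^+ 2] is at most
    [4 * s]. *)
Lemma householder_scalar_bound :
  2 * t ^+ 2 * y ^+ 2 / (x ^+ 2 * s) * x ^+ 2 + 2 * t / s * (2 * (x * y))
  + 2 * t ^+ 2 / s * y ^+ 2 <= 6 * (y / x).
Proof.
have -> : 2 * t ^+ 2 * y ^+ 2 / (x ^+ 2 * s) * x ^+ 2 + 2 * t / s * (2 * (x * y))
    + 2 * t ^+ 2 / s * y ^+ 2 = (4 * t ^+ 2 * y * x + 4 * t * x ^+ 2) * y / (x * s).
  by field; rewrite !gt_eqF.
rewrite ler_pdivrMr ?mulr_gt0//.
have -> : 6 * (y / x) * (x * s) = 6 * s * y by field; rewrite gt_eqF.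
rewrite ler_wpM2r//.
have txy : 0 <= t * (x * y) by rewrite !mulr_ge0// ltW.
have h1 : t * (t * (x * y)) <= t * (x * y) by rewrite ler_piMl.
have h2 : t * x ^+ 2 <= x ^+ 2 by rewrite ler_piMl// sqr_ge0.
have := xx_le_s; have := xy_le_s; move: s => u; lra.
Qed.

(** Same reading for the difference of derivatives, with 14 = 4 + 6 + 4. The outer terms use t x^4
    <= s^2; the middle one uses 2 t x y <= s and 2 t (3 x^2 + t^2 y^2) <= 6 s. *)
Lemma dhouseholder_scalar_bound :
  4 * t * y ^+ 2 / s ^+ 2 * x ^+ 2
  + 2 * t ^+ 2 * y ^+ 2 * (3 * x ^+ 2 + t ^+ 2 * y ^+ 2) / (x ^+ 2 * s ^+ 2) * (2 * (x * y))
  + 4 * t * x ^+ 2 / s ^+ 2 * y ^+ 2 <= 14 * (y / x) ^+ 2.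
Proof.
have -> : 14 * (y / x) ^+ 2 = y ^+ 2 * (4 / x ^+ 2) + y ^+ 2 * (6 / x ^+ 2)
    + y ^+ 2 * (4 / x ^+ 2) by field; rewrite gt_eqF.
have sx : x ^+ 2 * (t * x ^+ 2) <= s ^+ 2.
  rewrite [s ^+ 2]expr2; apply: ler_pM => //; rewrite ?(sqr_ge0, mulr_ge0) ?(ltW x0)//.
  by apply: le_trans xx_le_s; rewrite ler_piMl ?sqr_ge0.
have h1 : 4 * t * y ^+ 2 / s ^+ 2 * x ^+ 2 <= y ^+ 2 * (4 / x ^+ 2).
  have -> : 4 * t * y ^+ 2 / s ^+ 2 * x ^+ 2 = y ^+ 2 * (4 * (t * x ^+ 2) / s ^+ 2).
    by field; rewrite gt_eqF.
  rewrite ler_wpM2l ?sqr_ge0// ler_pdivrMr ?exprn_gt0// mulrAC ler_pdivlMr ?exprn_gt0//.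
  by rewrite -mulrA ler_pM2l// mulrC.
apply: lerD; last first.
  by rewrite (_ : _ * y ^+ 2 = 4 * t * y ^+ 2 / s ^+ 2 * x ^+ 2)//; ring.
apply: lerD => //.
have -> : 2 * t ^+ 2 * y ^+ 2 * (3 * x ^+ 2 + t ^+ 2 * y ^+ 2) / (x ^+ 2 * s ^+ 2) * (2 * (x * y))
   = y ^+ 2 * ((2 * (t * (x * y))) * (2 * (t * (3 * x ^+ 2 + t ^+ 2 * y ^+ 2))) / (x ^+ 2 * s ^+ 2)).
  by field; rewrite !gt_eqF.
rewrite ler_wpM2l ?sqr_ge0// ler_pdivrMr ?mulr_gt0 ?exprn_gt0//.
have -> : 6 / x ^+ 2 * (x ^+ 2 * s ^+ 2) = s * (6 * s) by field; rewrite gt_eqF.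
have p0 : 0 <= 3 * x ^+ 2 + t ^+ 2 * y ^+ 2 by rewrite ?(sqr_ge0, mulr_ge0, addr_ge0).
apply: ler_pM => //; rewrite ?mulr_ge0 ?(ltW x0)//.
have h : t * (3 * x ^+ 2 + t ^+ 2 * y ^+ 2) <= 3 * x ^+ 2 + t ^+ 2 * y ^+ 2.
  by rewrite ler_piMl.
have q : 0 <= t ^+ 2 * y ^+ 2 by rewrite mulr_ge0 ?sqr_ge0.
by rewrite /s; lra.
Qed.

End ScalarBounds.

Section Descent.
Variable R : realType.

(** Each of the two terms of [dhouseholder] contributes at most 4 |d|/|v|, by Cauchy-Schwarz. *)
Lemma frob_dhouseholder_le N (v d : 'cV[R]_N) :
  v != 0 -> frob (dhouseholder v d) <= 8 * (frob d / frob v).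
Proof.
move=> v0; have x0 : 0 < frob v by rewrite frob_gt0.
rewrite /dhouseholder -[frob2 v]sqr_frob.
apply: (le_trans (frobB _ _)); rewrite !frobZ frob_mulmx_tr.
have vd := normr_mxdot_le v d.
have hs : frob (d *m v^T + v *m d^T) <= 2 * (frob v * frob d).
  by rewrite (le_trans (frobD _ _))// !frob_mulmx_tr; lra.
have -> : 8 * (frob d / frob v) =
    4 * (frob v * frob d) / (frob v ^+ 2) ^+ 2 * (frob v * frob v)
    + 2 / frob v ^+ 2 * (2 * (frob v * frob d)) by field; rewrite gt_eqF.
apply: lerD.
  rewrite ler_wpM2r ?mulr_ge0 ?frob_ge0// !normrM normfV.
  rewrite (ger0_norm (_ : 0 <= 4))// (ger0_norm (exprn_ge0 _ _)) ?exprn_ge0 ?frob_ge0//.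
  by rewrite ler_wpM2r ?invr_ge0 ?exprn_ge0 ?frob_ge0// ler_wpM2l.
by rewrite ger0_norm ?divr_ge0 ?exprn_ge0 ?frob_ge0// ler_wpM2l// divr_ge0 ?exprn_ge0 ?frob_ge0.
Qed.

(** Differences of Householder matrices and of their derivatives along a segment lie in the span of
    these three matrices, so estimating them reduces to scalar coefficients. *)
Lemma frob_comb_le N (v d : 'cV[R]_N) a b c a' b' c' :
  `|a| <= a' -> `|b| <= b' -> `|c| <= c' ->
  frob (a *: (v *m v^T) + b *: (d *m v^T + v *m d^T) + c *: (d *m d^T))
  <= a' * frob v ^+ 2 + b' * (2 * (frob v * frob d)) + c' * frob d ^+ 2.
Proof.
move=> ha hb hc.
apply: (le_trans (frobD _ _)); apply: lerD; last first.
  by rewrite frobZ frob_mulmx_tr -expr2 ler_wpM2r// exprn_ge0 ?frob_ge0.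
apply: (le_trans (frobD _ _)); apply: lerD.
  by rewrite frobZ frob_mulmx_tr -expr2 ler_wpM2r// exprn_ge0 ?frob_ge0.
rewrite frobZ ler_pM ?frob_ge0// (le_trans (frobD _ _))// !frob_mulmx_tr.
by rewrite [frob d * _]mulrC; lra.
Qed.

Lemma frob2_orthD N (v d : 'cV[R]_N) t : mxdot v d = 0 ->
  frob2 (v + t *: d) = frob2 v + t ^+ 2 * frob2 d.
Proof.
move=> vd; rewrite -!mxdotxx mxdotDl !mxdotDr !mxdotZl !mxdotZr (mxdotC d v) vd.
by ring.
Qed.

Section Segment.
Variables (N : nat) (v d : 'cV[R]_N) (t : R).
Hypotheses (v0 : v != 0) (vd : mxdot v d = 0) (t01 : 0 <= t <= 1).

Let x0 : 0 < frob v. Proof. by rewrite frob_gt0. Qed.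
Let x0' : frob v != 0. Proof. by rewrite gt_eqF. Qed.
Let s0 : frob v ^+ 2 + t ^+ 2 * frob d ^+ 2 != 0.
Proof. by rewrite gt_eqF// ltr_wpDr ?(sqr_ge0, mulr_ge0) ?exprn_gt0. Qed.
Let sE : frob2 (v + t *: d) = frob v ^+ 2 + t ^+ 2 * frob d ^+ 2.
Proof. by rewrite frob2_orthD// !sqr_frob. Qed.
Let t_ge0 : 0 <= t. Proof. by case/andP: t01. Qed.
Let t_le1 : t <= 1. Proof. by case/andP: t01. Qed.

Lemma frob_orthD_ge : frob v <= frob (v + t *: d).
Proof. by apply: le_frob; rewrite frob2_orthD// lerDl mulr_ge0 ?sqr_ge0 ?frob2_ge0. Qed.

Lemma orthD_neq0 : v + t *: d != 0.
Proof. by rewrite -frob_gt0 (lt_le_trans x0) ?frob_orthD_ge. Qed.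

Lemma frob_householder_diff_le :
  frob (householder (v + t *: d) - householder v) <= 6 * (frob d / frob v).
Proof.
have := householder_scalar_bound x0 (frob_ge0 d) t_ge0 t_le1.
set x := frob v; set y := frob d; set s := x ^+ 2 + _ => h.
(* The coefficient of v v^T is 2/x^2 - 2/s, reduced with s - x^2 = t^2 y^2. *)
have -> : householder (v + t *: d) - householder v =
    (2 * t ^+ 2 * y ^+ 2 / (x ^+ 2 * s)) *: (v *m v^T)
    + (- (2 * t / s)) *: (d *m v^T + v *m d^T) + (- (2 * t ^+ 2 / s)) *: (d *m d^T).
  apply/matrixP => i j.
  rewrite [LHS]mxE [X in _ + X = _]mxE !householderE sE -[frob2 v]sqr_frob -/x -/y -/s !mxE !big_ord1 !mxE.
  by rewrite /s; field; rewrite exprMn ?x0' ?s0.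
apply: (le_trans _ h); apply: frob_comb_le; rewrite ?normrN ger0_norm//.
all: have s_ge0 : 0 <= s by rewrite ?(sqr_ge0, mulr_ge0, addr_ge0).
all: by rewrite divr_ge0 ?(sqr_ge0, mulr_ge0).
Qed.

Lemma frob_dhouseholder_diff_le :
  frob (dhouseholder (v + t *: d) d - dhouseholder v d) <= 14 * (frob d / frob v) ^+ 2.
Proof.
have := dhouseholder_scalar_bound x0 (frob_ge0 d) t_ge0 t_le1.
set x := frob v; set y := frob d; set s := x ^+ 2 + _ => h.
(* Orthogonality removes the first term of [dhouseholder v d] and turns <v + t d, d> into t y^2. *)
have -> : dhouseholder (v + t *: d) d - dhouseholder v d =
    (4 * t * y ^+ 2 / s ^+ 2) *: (v *m v^T)
    + (2 * t ^+ 2 * y ^+ 2 * (3 * x ^+ 2 + t ^+ 2 * y ^+ 2) / (x ^+ 2 * s ^+ 2))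
      *: (d *m v^T + v *m d^T)
    + (- (4 * t * x ^+ 2 / s ^+ 2)) *: (d *m d^T).
  apply/matrixP => i j.
  rewrite [LHS]mxE [X in _ + X = _]mxE !dhouseholderE sE mxdotDl mxdotZl vd mxdotxx -[frob2 v]sqr_frob.
  rewrite -[frob2 d]sqr_frob -/x -/y -/s !mxE !big_ord1 !mxE.
  by rewrite /s; field; rewrite exprMn ?x0' ?s0.
apply: (le_trans _ h); apply: frob_comb_le; rewrite ?normrN ger0_norm//.
all: have s_ge0 : 0 <= s by rewrite ?(sqr_ge0, mulr_ge0, addr_ge0).
all: by rewrite divr_ge0 ?(sqr_ge0, mulr_ge0, addr_ge0) ?exprn_ge0.
Qed.

End Segment.

Section ProductBounds.
Variables (N L : nat).
Implicit Types (vs ds : 'I_L -> 'cV[R]_N) (s : seq 'I_L).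

(** In the product rule every undifferentiated factor is orthogonal and leaves the norm unchanged,
    so each position contributes 8 D. *)
Lemma frob_dprodHs_le vs ds s D : (forall l, vs l != 0) ->
  (forall l, frob (ds l) / frob (vs l) <= D) ->
  frob (dprodHs vs ds s) <= 8 * (size s)%:R * D.
Proof.
move=> vs0 hD; elim: s => [|l s IHs] /=.
  by rewrite mulr0 mul0r -(scale0r 0) frobZ normr0 mul0r.
apply: (le_trans (frobD _ _)).
rewrite (frob_mul_mxOr _ (mxO_prodHs _ vs0)) (frob_mul_mxOl _ (mxO_householder (vs0 l))).
have := frob_dhouseholder_le (ds l) (vs0 l); have := hD l.
by rewrite -[(size s).+1%:R]natr1; lra.
Qed.

Variables (vs ds : 'I_L -> 'cV[R]_N) (t D : R).
Hypotheses (vs0 : forall l, vs l != 0) (orth : forall l, mxdot (vs l) (ds l) = 0).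
Hypotheses (t01 : 0 <= t <= 1) (hD : forall l, frob (ds l) / frob (vs l) <= D).
Let ws l := vs l + t *: ds l.
Let ws0 l : ws l != 0. Proof. exact: orthD_neq0. Qed.

(** Replacing one factor at a time costs 6 D per position. *)
Lemma frob_prodHs_diff_le s :
  frob (prodHs ws s - prodHs vs s) <= 6 * (size s)%:R * D.
Proof.
elim: s => [|l s IHs] /=; first by rewrite mulr0 mul0r subrr -(scale0r 0) frobZ normr0 mul0r.
rewrite mulmx_diff.
apply: (le_trans (frobD _ _)).
rewrite (frob_mul_mxOr _ (mxO_prodHs _ ws0)) (frob_mul_mxOl _ (mxO_householder (vs0 l))).
have := frob_householder_diff_le (vs0 l) (orth l) t01; have := hD l.
by rewrite -[(size s).+1%:R]natr1 -/(ws l); lra.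
Qed.

Lemma ratio_le_ws l : frob (ds l) / frob (ws l) <= D.
Proof.
apply: le_trans (hD l); rewrite ler_wpM2l ?frob_ge0// lef_pV2 ?posrE ?frob_gt0//.
exact: frob_orthD_ge.
Qed.

(** Adding a factor in front of [n] others costs 14 D^2 for the change of its own derivative, and 8
    D (6 n D) + 6 D (8 n D) = 96 n D^2 for the two mixed terms; 96 n^2 dominates the accumulated
    sum. *)
Lemma frob_dprodHs_diff_le s :
  frob (dprodHs ws ds s - dprodHs vs ds s)
  <= (14 * (size s)%:R + 96 * (size s)%:R ^+ 2) * D ^+ 2.
Proof.
elim: s => [|l s IHs] /=.
  by rewrite expr0n !mulr0 addr0 mul0r subrr -(scale0r 0) frobZ normr0 mul0r.
rewrite (_ : _ - _ = (dhouseholder (ws l) (ds l) - dhouseholder (vs l) (ds l)) *m prodHs ws s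
    + dhouseholder (vs l) (ds l) *m (prodHs ws s - prodHs vs s)
    + ((householder (ws l) - householder (vs l)) *m dprodHs ws ds s
    + householder (vs l) *m (dprodHs ws ds s - dprodHs vs ds s))); last first.
  by rewrite opprD addrACA !mulmx_diff.
have D0 : 0 <= D by apply: le_trans (hD l); rewrite divr_ge0 ?frob_ge0.
have h1 : frob (dhouseholder (ws l) (ds l) - dhouseholder (vs l) (ds l)) <= 14 * D ^+ 2.
  apply: (le_trans (frob_dhouseholder_diff_le (vs0 l) (orth l) t01)).
  by rewrite ler_wpM2l// lerXn2r ?nnegrE// divr_ge0 ?frob_ge0.
have h2 : frob (dhouseholder (vs l) (ds l) *m (prodHs ws s - prodHs vs s))
    <= (8 * D) * (6 * (size s)%:R * D).
  apply: (le_trans (frobM _ _)); rewrite ler_pM ?frob_ge0 ?frob_prodHs_diff_le//.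
  by apply: (le_trans (frob_dhouseholder_le (ds l) (vs0 l))); rewrite ler_wpM2l.
have h3 : frob ((householder (ws l) - householder (vs l)) *m dprodHs ws ds s)
    <= (6 * D) * (8 * (size s)%:R * D).
  apply: (le_trans (frobM _ _)); rewrite ler_pM ?frob_ge0//.
    apply: (le_trans (frob_householder_diff_le (vs0 l) (orth l) t01)).
    by rewrite ler_wpM2l.
  by apply: frob_dprodHs_le => //; exact: ratio_le_ws.
apply: (le_trans (frobD _ _)).
have := frobD ((dhouseholder (ws l) (ds l) - dhouseholder (vs l) (ds l)) *m prodHs ws s)
  (dhouseholder (vs l) (ds l) *m (prodHs ws s - prodHs vs s)).
have := frobD ((householder (ws l) - householder (vs l)) *m dprodHs ws ds s)
  (householder (vs l) *m (dprodHs ws ds s - dprodHs vs ds s)).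
rewrite (frob_mul_mxOr _ (mxO_prodHs _ ws0)) (frob_mul_mxOl _ (mxO_householder (vs0 l))).
have n0 : 0 <= (size s)%:R * D ^+ 2 by rewrite mulr_ge0 ?sqr_ge0.
have DD := sqr_ge0 D.
rewrite -[(size s).+1%:R]natr1; move: ((size s)%:R) h2 h3 IHs n0 => n h2 h3 IHs n0 k1 k2.
have e : (14 * (n + 1) + 96 * (n + 1) ^+ 2) * D ^+ 2 =
   (14 * n + 96 * n ^+ 2) * D ^+ 2 + 14 * D ^+ 2 + 8 * D * (6 * n * D) + 6 * D * (8 * n * D)
   + 96 * (n * D ^+ 2) + 96 * D ^+ 2 by ring.
by rewrite e; lra.
Qed.

End ProductBounds.

Lemma is_diff_segment N L (vs ds : 'I_L -> 'cV[R]_N) (t : R) l :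
  is_diff t (fun u : R => vs l + u *: ds l) (fun u : R => u *: ds l).
Proof.
have d1 : is_diff t (cst (vs l)) 0 by exact: is_diff_cst.
have d2 : is_diff t (fun u : R => u *: ds l) (fun u : R => u *: ds l).
  exact: is_diff_scalel.
by apply: (is_diff_eq (is_diffD d1 d2)); rewrite add0r.
Qed.

(* The segment avoids 0 because each [ds l] is orthogonal to [vs l]; the mean value theorem along it only meets orthogonal matrices, where [grad f] is Lipschitz. *)
Lemma prodH_descent N L (f : 'M[R]_N -> R) (M1 G D : R) (vs ds : 'I_L -> 'cV[R]_N) :
  (forall X, differentiable f X) -> 0 <= M1 ->
  (forall X' X'', mxO X' -> mxO X'' ->
     frob (grad f X' - grad f X'') <= M1 * frob (X' - X'')) ->
  (forall X, mxO X -> frob (grad f X) <= G) ->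
  (forall l, vs l != 0) -> (forall l, mxdot (vs l) (ds l) = 0) ->
  (forall l, frob (ds l) / frob (vs l) <= D) ->
  f (prodH (fun l => vs l + ds l)) - f (prodH vs) <=
  mxdot (grad f (prodH vs)) (dprodH vs ds)
  + (M1 * (48 * L%:R ^+ 2) + G * (14 * L%:R + 96 * L%:R ^+ 2)) * D ^+ 2.
Proof.
move=> df M10 lipf gradb vs0 orth hD.
pose w (t : R) l := vs l + t *: ds l.
pose phi (t : R) := f (prodH (w t)).
pose dphi (t : R) := mxdot (grad f (prodH (w t))) (dprodH (w t) ds).
have w0 t : (forall l, w t l != 0).
  move=> l; rewrite /w -frob2_gt0 frob2_orthD// ltr_pwDl ?frob2_gt0//.
  by rewrite mulr_ge0 ?sqr_ge0 ?frob2_ge0.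
have dphiP t : is_diff t phi (fun u => u * dphi t).
  have dP := @is_diff_prodH _ _ _ _ w (fun u l => u *: ds l) t
    (is_diff_segment vs ds t) (w0 t).
  have dfP : is_diff (prodH (w t)) f ('d f (prodH (w t))) by exact: differentiableP.
  apply: (is_diff_eq (is_diff_comp dP dfP)).
  by apply/funext => u /=; rewrite dprodHZ grad_mxdot mxdotZr.
have dphiD (t : R) : is_derive t (1 : R) phi (dphi t).
  have dt : differentiable phi t by exact: (@ex_diff _ _ _ _ _ _ _ (dphiP t)).
  apply: DeriveDef; first exact: diff_derivable.
  by rewrite deriveE// (@diff_val _ _ _ _ _ _ _ (dphiP t)) mul1r.
have cphi : {within `[0, 1], continuous phi}.
  apply: derivable_within_continuous => t _; exact: (@ex_derive _ _ _ _ _ _ _ (dphiD t)).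
have [c c01] := MVT (@ltr01 R) (fun t _ => dphiD t) cphi.
rewrite subr0 mulr1 => phiE.
have {}c01 : 0 <= c <= 1 by move: c01; rewrite in_itv/= => /andP[/ltW -> /ltW ->].
have w1 : w 1 = (fun l => vs l + ds l) by apply/funext => l; rewrite /w scale1r.
have wz : w 0 = vs by apply/funext => l; rewrite /w scale0r addr0.
rewrite -w1.
have -> : f (prodH (w 1)) - f (prodH vs) = dphi c by rewrite -phiE /phi wz.
have sz : size (enum 'I_L) = L by rewrite size_enum_ord.
rewrite -lerBlDl.
(* The change of gradient, at most M1 (6 L D), meets a derivative of norm at most 8 L D, whence 48
   L^2; the change of derivative meets a gradient of norm at most [G]. *)
rewrite /dphi mxdot_diff.
have b1 : frob (prodH (w c) - prodH vs) <= 6 * L%:R * D.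
  by have := frob_prodHs_diff_le vs0 orth c01 hD (enum 'I_L); rewrite sz.
have b2 : frob (dprodH (w c) ds) <= 8 * L%:R * D.
  have := @frob_dprodHs_le _ _ (w c) ds (enum 'I_L) D (w0 c).
  by rewrite sz; apply; exact: ratio_le_ws.
have b3 : frob (dprodH (w c) ds - dprodH vs ds) <= (14 * L%:R + 96 * L%:R ^+ 2) * D ^+ 2.
  by have := frob_dprodHs_diff_le vs0 orth c01 hD (enum 'I_L); rewrite sz.
have vO := mxO_prodH vs0; have wO := mxO_prodH (w0 c).
rewrite mulrDl; apply: lerD; apply: (le_trans (mxdot_le _ _)).
  have -> : M1 * (48 * L%:R ^+ 2) * D ^+ 2 = (M1 * (6 * L%:R * D)) * (8 * L%:R * D) by ring.
  rewrite ler_pM ?frob_ge0//.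
  by apply: (le_trans (lipf _ _ wO vO)); rewrite ler_wpM2l.
by rewrite -mulrA ler_pM ?frob_ge0 ?gradb.
Qed.

End Descent.

(** * Lengths of the iterates and the one-step inequality *)

Section Iterates.
Variables (R : realType) (N L : nat).
Implicit Types (vs : 'I_L -> 'cV[R]_N) (gt : nat -> 'M[R]_N -> R).

(** Both claims share one induction: orthogonality of the gradient requires nonzero vectors, and the
    growth of the lengths that it yields keeps them nonzero. *)
Lemma iterate_frob_ge gt vs :
  (forall k X, differentiable (gt k) X) -> (forall l, vs l != 0) ->
  forall k, (forall l, iterate gt vs k l != 0) /\
    (forall l, frob (vs l) <= frob (iterate gt vs k l)).
Proof.
move=> dgt vs0; elim => [//|k [IH0 IHle]].
have H l : frob (iterate gt vs k l) <= frob (iterate gt vs k.+1 l).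
  rewrite /= -scaleNr; apply: le_frob; rewrite frob2_orthD.
    by rewrite lerDl mulr_ge0 ?sqr_ge0 ?frob2_ge0.
  by rewrite mxdotC mxdot_gradv_orth.
split=> l; last exact: le_trans (IHle l) (H l).
by rewrite -frob_gt0 (lt_le_trans _ (H l))// frob_gt0.
Qed.

(** Testing the adjoint relation on the gradient itself bounds its squared norm by |grad g| times 8
    L |gradv g| / c; one power of |gradv g| is then cancelled, the zero case being set apart. *)
Lemma frob_gradv_le (g : 'M[R]_N -> R) vs l c :
  (forall X, differentiable g X) -> 0 < c -> (forall l, c <= frob (vs l)) ->
  frob (gradv g vs l) <= 8 * L%:R / c * frob (grad g (prodH vs)).
Proof.
move=> dg c0 hc; set x := frob _; set G := frob _.
have vs0 l' : vs l' != 0 by rewrite -frob_gt0 (lt_le_trans c0).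
have x0 : 0 <= x by exact: frob_ge0.
have [->|xn0] := eqVneq x 0; first by rewrite !mulr_ge0 ?invr_ge0 ?frob_ge0// ltW.
have xp : 0 < x by rewrite lt_def xn0.
have sD l' : frob (single l (gradv g vs l) l') / frob (vs l') <= x / c.
  rewrite ler_pM ?frob_ge0 ?invr_ge0 ?frob_ge0//; last first.
    by rewrite lef_pV2 ?posrE ?frob_gt0.
  by rewrite /single; case: ifP => // _; rewrite -(scale0r 0) frobZ normr0 mul0r.
have h : x ^+ 2 <= G * (8 * L%:R * (x / c)).
  rewrite sqr_frob -mxdotxx mxdot_gradv//; apply: (le_trans (mxdot_le _ _)).
  rewrite ler_wpM2l ?frob_ge0//.
  by have := frob_dprodHs_le (enum 'I_L) vs0 sD; rewrite size_enum_ord.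
by rewrite -(ler_pM2r xp) -expr2 (le_trans h)// le_eqVlt; apply/orP; left; apply/eqP; ring.
Qed.

(** [C] is chosen before the sample, the vectors and the step size, so one constant serves all
    outcomes and iterations. The first-order term is stated so that [g] appears only through
    [grad g] at the current product. *)
Lemma gradv_step_descent (f : 'M[R]_N -> R) (M1 G c : R) :
  (forall X, differentiable f X) -> 0 <= M1 ->
  (forall X' X'', mxO X' -> mxO X'' ->
     frob (grad f X' - grad f X'') <= M1 * frob (X' - X'')) ->
  (forall X, mxO X -> frob (grad f X) <= G) -> 0 < c ->
  exists2 C, 0 <= C & forall (g : 'M[R]_N -> R) vs eta, (forall X, differentiable g X) ->
    (forall l, c <= frob (vs l)) -> 0 <= eta ->
    f (prodH (fun l => vs l - eta *: gradv g vs l)) - f (prodH vs) <=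
    - (eta * mxdot (grad g (prodH vs)) (dprodH vs (gradv f vs)))
    + eta ^+ 2 * (C * frob2 (grad g (prodH vs))).
Proof.
move=> df M10 lipf gradb c0.
have G0 : 0 <= G by apply: le_trans (gradb _ (mxO1 R N)); exact: frob_ge0.
pose C1 := M1 * (48 * L%:R ^+ 2) + G * (14 * L%:R + 96 * L%:R ^+ 2).
have C10 : 0 <= C1.
  have L0 : 0 <= L%:R :> R by [].
  by rewrite addr_ge0// mulr_ge0// ?addr_ge0// mulr_ge0// sqr_ge0.
(* The relative step |ds_l|/|vs_l| is at most eta (8 L / c / c) |grad g|: one division by [c] bounds
   the gradient, the other is the length of the vector. *)
exists (C1 * (8 * L%:R / c / c) ^+ 2); first by rewrite mulr_ge0 ?sqr_ge0.
move=> g vs eta dg hc eta0.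
have vs0 l' : vs l' != 0 by rewrite -frob_gt0 (lt_le_trans c0).
pose ds l := (- eta) *: gradv g vs l.
have -> : (fun l => vs l - eta *: gradv g vs l) = (fun l => vs l + ds l).
  by apply/funext => l; rewrite /ds scaleNr.
have orth l : mxdot (vs l) (ds l) = 0.
  by rewrite mxdotC mxdotZl mxdot_gradv_orth// mulr0.
have hD l : frob (ds l) / frob (vs l) <= eta * (8 * L%:R / c / c * frob (grad g (prodH vs))).
  have -> : eta * (8 * L%:R / c / c * frob (grad g (prodH vs))) =
    (eta * (8 * L%:R / c * frob (grad g (prodH vs)))) / c by ring.
  rewrite ler_pM ?frob_ge0 ?invr_ge0 ?frob_ge0//; last first.
    by rewrite lef_pV2 ?posrE ?frob_gt0.
  by rewrite frobZ normrN ger0_norm// ler_wpM2l// frob_gradv_le.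
apply: (le_trans (prodH_descent df M10 lipf gradb vs0 orth hD)).
(* Adjointness is used twice: <grad f, dQ(ds)> is -eta times the sum over [l] of <gradv f, gradv g>,
   and this sum is also <grad g, dQ(gradv f)>. *)
rewrite -/C1 -(mxdot_gradv_sum ds df vs0) -(mxdot_gradv_sum _ dg vs0).
apply: lerD.
  rewrite mulr_sumr -sumrN le_eqVlt; apply/orP; left; apply/eqP.
  by apply: eq_bigr => l _; rewrite mxdotZr mulNr mxdotC.
by rewrite -sqr_frob le_eqVlt; apply/orP; left; apply/eqP; ring.
Qed.

Lemma frob_grad_bound (f : 'M[R]_N -> R) (M1 : R) : 0 <= M1 ->
  (forall X' X'', mxO X' -> mxO X'' ->
     frob (grad f X' - grad f X'') <= M1 * frob (X' - X'')) ->
  forall X, mxO X ->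
    frob (grad f X) <= frob (grad f 1%:M) + M1 * (2 * frob (1%:M : 'M[R]_N)).
Proof.
move=> M10 lipf X XO; rewrite -[grad f X](subrK (grad f 1%:M)) addrC.
apply: (le_trans (frobD _ _)); rewrite lerD2l.
apply: (le_trans (lipf _ _ XO (mxO1 R N))); rewrite ler_wpM2l//.
by apply: (le_trans (frobB _ _)); rewrite (frob_mxO XO); lra.
Qed.

(** Entries of an orthogonal matrix are at most |I|_F in absolute value, so [f] is only evaluated on
    a compact cube. The cube lives in row vectors, where [rV_compact] applies, and [vec_mx] carries
    it to matrices. *)
Lemma mxO_bounded (f : 'M[R]_N -> R) : (forall X, differentiable f X) ->
  exists B, forall X, mxO X -> `|f X| <= B.
Proof.
move=> df.
have cf : continuous f by move=> X; exact: differentiable_continuous.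
pose K : set 'rV[R]_(N * N) :=
  [set v | forall i, `[- frob (1%:M : 'M[R]_N), frob (1%:M : 'M[R]_N)]%classic (v ord0 i)].
have cK : compact K.
  apply: (@rV_compact _ _ (fun=> `[- frob (1%:M : 'M[R]_N), frob (1%:M : 'M[R]_N)]%classic)).
  by move=> _; exact: segment_compact.
have cv : continuous (vec_mx : 'rV[R]_(N * N) -> 'M[R]_N).
  move=> v.
  have dv : is_diff v (vec_mx : 'rV[R]_(N * N) -> 'M[R]_N) vec_mx.
    apply: is_diff_mx => i j.
    rewrite (_ : (fun y => _) = (fun y : 'rV[R]_(N * N) => y ord0 (mxvec_index i j))).
      exact: is_diff_entry (is_diff_id _).
    by apply/funext => y; rewrite mxE.
  by apply: differentiable_continuous; exact: (@ex_diff _ _ _ _ _ _ _ dv).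
have cfv : {within K, continuous (fun v : 'rV[R]_(N * N) => f (vec_mx v))}.
  apply: continuous_subspaceT => v; apply: continuous_comp; [exact: cv|exact: cf].
have [B HB] := compact_bounded (continuous_compact cfv cK).
(* [compact_bounded] gives a bound by every real strictly above [B]. *)
exists (`|B| + 1) => X XO; apply: (HB.2 (`|B| + 1)).
  by rewrite ltr_pwDr// ler_norm.
exists (mxvec X); last by rewrite mxvecK.
move=> k; case/mxvec_indexP: k => i j; rewrite mxvecE /= in_itv/=.
by rewrite -ler_norml -(frob_mxO XO) normr_entry_le.
Qed.

End Iterates.

(** * Measurability and independence *)

Section MatrixMeasurability.
Variable R : realType.

(** An open set is the countable union of the balls with rational centre and radius 1/(k+1) that it
    contains, and the preimage of such a ball is a finite intersection of entrywise conditions. *)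
Lemma measurable_fun_mxBorel d (T : measurableType d) m n (F : T -> 'M[R]_(m, n)) :
  (forall i j, measurable_fun setT (fun w => F w i j)) ->
  measurable_fun setT (F : T -> mxBorel R m n).
Proof.
move=> mF; apply: (@measurability _ _ T (mxBorel R m n) setT F (@open 'M[R]_(m, n))) => // _ [U oU <-].
rewrite setTI.
pose bl (p : 'M[rat]_(m, n) * nat) : set 'M[R]_(m, n) :=
  [set X | forall i j, `|ratr (p.1 i j) - X i j| < p.2.+1%:R^-1].
pose I := [set p | bl p `<=` U].
have -> : F @^-1` U = \bigcup_p (if p \in I then F @^-1` (bl p) else set0).
  apply/seteqP; split => w; last first.
    by case=> p _; case: ifPn => // /set_mem pI /pI.
  move=> /= FU; have /nbhs_ballP[e /= e0 eU] : nbhs (F w) U.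
    by move: oU; rewrite openE => /(_ _ FU).
  (* Half of [e]: [F w] and any point of the chosen ball are both within the radius of its rational
     centre. *)
  have [k ke] : exists k : nat, k.+1%:R^-1 < e / 2.
    by have [k _ /(_ k (leqnn k)) kk] := near_infty_natSinv_lt (PosNum (divr_gt0 e0 (ltr0Sn R 1)));
      exists k.
  have k0 : 0 < k.+1%:R^-1 :> R by rewrite invr_gt0.
  have /= /choice[q qP] : forall ij : 'I_m * 'I_n, exists q : rat,
      `|ratr q - F w ij.1 ij.2| < k.+1%:R^-1.
    move=> ij.
    have [q] : exists q : rat, ratr q \in `](F w ij.1 ij.2 - k.+1%:R^-1), (F w ij.1 ij.2 + k.+1%:R^-1)[%R.
      by apply: rat_in_itvoo; rewrite ltrBlDr -addrA ltrDl addr_gt0.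
    by rewrite in_itv/= => q12; exists q; rewrite ltr_distl.
  exists (\matrix_(i, j) q (i, j), k) => //.
  rewrite mem_set; first by move=> i j /=; rewrite mxE; exact: qP.
  move=> X /= Xb; apply: eU; split => // i j.
  have /= := Xb i j; rewrite mxE => Xq.
  have /= qF := qP (i, j); rewrite /ball /=.
  have := ler_distD (ratr (q (i, j))) (F w i j) (X i j).
  by rewrite (distrC (F w i j) (ratr _)); move: (k.+1%:R^-1) ke Xq qF => r; lra.
apply: countable_bigcupT_measurable; first exact: countableP.
move=> p; case: ifPn => // _.
have -> : F @^-1` bl p = \bigcap_(ij : 'I_m * 'I_n)
    [set w | `|ratr (p.1 ij.1 ij.2) - F w ij.1 ij.2| < p.2.+1%:R^-1].
  apply/seteqP; split => [w /= h ij _|w /= h i j]; first exact: h.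
  exact: (h (i, j)).
apply: fin_bigcap_measurable => // ij _.
have mf : measurable_fun setT (fun w => `|ratr (p.1 ij.1 ij.2) - F w ij.1 ij.2|).
  by apply: measurableT_comp => //; apply: measurable_funB.
rewrite -[X in measurable X]setTI.
by have := mf measurableT _ (@measurable_itv R `]-oo, p.2.+1%:R^-1[);
  congr measurable; apply/seteqP; split => w /=; rewrite in_itv.
Qed.

Lemma continuous_measurable_mxBorel m n (F : 'M[R]_(m, n) -> R) :
  continuous F -> measurable_fun setT (F : mxBorel R m n -> R).
Proof.
move=> cF; apply: (@measurability _ _ (mxBorel R m n) _ setT F _ (RGenOInfty.measurableE R)) => _ [_ [x ->] <-].
rewrite setTI; apply: sub_sigma_algebra.
by apply: open_comp => [X _|]; [exact: cF|exact: rray_open].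
Qed.

(** A partial derivative is the pointwise limit of the difference quotients with increments 1/(k+1),
    which are continuous in [X]. *)
Lemma measurable_grad m n (f : 'M[R]_(m, n) -> R) i j :
  (forall X, differentiable f X) ->
  measurable_fun setT (fun X : mxBorel R m n => grad f X i j).
Proof.
move=> df.
have cf : continuous f by move=> X; exact: differentiable_continuous.
pose h k (X : 'M[R]_(m, n)) : R :=
  k.+1%:R * (f ((k.+1%:R^-1 : R) *: delta_mx i j + X) - f X).
apply: (@measurable_fun_cvg _ (mxBorel R m n) R setT h) => [k|X _].
  apply: continuous_measurable_mxBorel => X.
  have cs : {for X, continuous (fun Y => f ((k.+1%:R^-1 : R) *: delta_mx i j + Y))}.
    apply: continuous_comp; last exact: cf.
    by apply: continuousD; [exact: cst_continuous|exact: cvg_id].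
  have cd : {for X, continuous (fun Y => f ((k.+1%:R^-1 : R) *: delta_mx i j + Y) - f Y)}.
    by apply: continuousB; [exact: cs|exact: cf].
  have cm : {for X, continuous (fun Y =>
      k.+1%:R * (f ((k.+1%:R^-1 : R) *: delta_mx i j + Y) - f Y))}.
    by apply: continuousM; [exact: cst_continuous|exact: cd].
  exact: cm.
rewrite mxE -deriveE//.
have /cvg_ex[l dl] := @diff_derivable _ _ _ _ X (delta_mx i j) (df X).
rewrite /derive (cvg_lim _ dl)//.
have := (cvgr_dnbhsP _ _ _).1 dl (fun k => k.+1%:R^-1).
rewrite (_ : (fun k : nat => _ *: _) = h ^~ X); last first.
  by apply/funext => k; rewrite /h invrK.
by apply; split; [move=> k; rewrite invr_eq0|exact: cvg_harmonic].
Qed.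

Section Entrywise.
Context d (T : measurableType d).

(** The entrywise form is stable under matrix algebra; [measurable_fun_mxBorel] returns to the Borel
    structure where compositions need it. *)
Definition mxmeas m n (F : T -> 'M[R]_(m, n)) :=
  forall i j, measurable_fun setT (fun w => F w i j).

Lemma mxmeas_cst m n (A : 'M[R]_(m, n)) : mxmeas (fun=> A).
Proof. by move=> i j; exact: measurable_cst. Qed.

Lemma mxmeasD m n (F G : T -> 'M[R]_(m, n)) :
  mxmeas F -> mxmeas G -> mxmeas (fun w => F w + G w).
Proof.
move=> mF mG i j; under eq_fun do rewrite mxE; exact: measurable_funD.
Qed.

Lemma mxmeasZ m n (a : T -> R) (F : T -> 'M[R]_(m, n)) :
  measurable_fun setT a -> mxmeas F -> mxmeas (fun w => a w *: F w).
Proof.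
move=> ma mF i j; under eq_fun do rewrite mxE; exact: measurable_funM.
Qed.

Lemma mxmeasB m n (F G : T -> 'M[R]_(m, n)) :
  mxmeas F -> mxmeas G -> mxmeas (fun w => F w - G w).
Proof.
move=> mF mG; apply: mxmeasD => //.
by under eq_fun do rewrite -scaleN1r; exact: mxmeasZ.
Qed.

Lemma mxmeas_tr m n (F : T -> 'M[R]_(m, n)) : mxmeas F -> mxmeas (fun w => (F w)^T).
Proof. by move=> mF i j; under eq_fun do rewrite mxE; exact: mF. Qed.

Lemma mxmeasM m n p (F : T -> 'M[R]_(m, n)) (G : T -> 'M[R]_(n, p)) :
  mxmeas F -> mxmeas G -> mxmeas (fun w => F w *m G w).
Proof.
move=> mF mG i j; under eq_fun do rewrite mxE.
by apply: measurable_sum => k; exact: measurable_funM.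
Qed.

Lemma measurable_mxdot m n (F G : T -> 'M[R]_(m, n)) :
  mxmeas F -> mxmeas G -> measurable_fun setT (fun w => mxdot (F w) (G w)).
Proof.
move=> mF mG; apply: measurable_sum => i; apply: measurable_sum => j.
exact: measurable_funM.
Qed.

Lemma measurable_frob2 m n (F : T -> 'M[R]_(m, n)) :
  mxmeas F -> measurable_fun setT (fun w => frob2 (F w)).
Proof. by move=> mF; under eq_fun do rewrite -mxdotxx; exact: measurable_mxdot. Qed.

Lemma measurable_invr_frob2 m n (F : T -> 'M[R]_(m, n)) :
  mxmeas F -> measurable_fun setT (fun w => (frob2 (F w))^-1).
Proof.
move=> mF; under eq_fun do rewrite -(powR_inv1 (frob2_ge0 _)).
apply: (@measurableT_comp _ _ _ _ _ _ (fun x : R => x `^ (-1))).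
- exact: measurable_powR.
- exact: measurable_frob2.
Qed.

Variables N L : nat.
Implicit Types (v e : T -> 'cV[R]_N) (vs ds : T -> 'I_L -> 'cV[R]_N).

Lemma mxmeas_householder v : mxmeas v -> mxmeas (fun w => householder (v w)).
Proof.
move=> mv; apply: mxmeasB; first exact: mxmeas_cst.
apply: mxmeasZ; last by apply: mxmeasM => //; exact: mxmeas_tr.
by apply: measurable_funM => //; exact: measurable_invr_frob2.
Qed.

Lemma mxmeas_dhouseholder v e :
  mxmeas v -> mxmeas e -> mxmeas (fun w => dhouseholder (v w) (e w)).
Proof.
move=> mv me; have mi := measurable_invr_frob2 mv.
apply: mxmeasB; apply: mxmeasZ.
- apply: measurable_funM; first by apply: measurable_funM => //; exact: measurable_mxdot.
  by under eq_fun do rewrite -exprVn; exact: measurable_funX.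
- by apply: mxmeasM => //; exact: mxmeas_tr.
- exact: measurable_funM.
- by apply: mxmeasD; apply: mxmeasM => //; exact: mxmeas_tr.
Qed.

Lemma mxmeas_prodHs vs s : (forall l, mxmeas (vs ^~ l)) ->
  mxmeas (fun w => prodHs (vs w) s).
Proof.
move=> mvs; elim: s => [|l s IHs] /=; first exact: mxmeas_cst.
by apply: mxmeasM => //; exact: mxmeas_householder.
Qed.

Lemma mxmeas_prodH vs : (forall l, mxmeas (vs ^~ l)) -> mxmeas (fun w => prodH (vs w)).
Proof. exact: mxmeas_prodHs. Qed.

Lemma mxmeas_dprodH vs ds : (forall l, mxmeas (vs ^~ l)) -> (forall l, mxmeas (ds ^~ l)) ->
  mxmeas (fun w => dprodH (vs w) (ds w)).
Proof.
move=> mvs mds; rewrite /dprodH; elim: (enum _) => [|l s IHs] /=; first exact: mxmeas_cst.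
apply: mxmeasD; apply: mxmeasM => //.
- exact: mxmeas_dhouseholder.
- exact: mxmeas_prodHs.
- exact: mxmeas_householder.
Qed.

(** Replaces a differential of a composite by an explicit expression in [grad g] and the vectors,
    whose measurability can be read off. *)
Lemma gradvE (g : 'M[R]_N -> R) (us : 'I_L -> 'cV[R]_N) l i j :
  (forall X, differentiable g X) -> (forall l, us l != 0) ->
  gradv g us l i j = mxdot (grad g (prodH us)) (dprodH us (single l (delta_mx i j))).
Proof. by move=> dg us0; rewrite -mxdot_gradv// mxdot_delta. Qed.

Lemma mxmeas_gradv (g : T -> 'M[R]_N -> R) vs l :
  (forall w X, differentiable (g w) X) -> (forall w l, vs w l != 0) ->
  mxmeas (fun w => grad (g w) (prodH (vs w))) -> (forall l, mxmeas (vs ^~ l)) ->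
  mxmeas (fun w => gradv (g w) (vs w) l).
Proof.
move=> dg vs0 mg mvs i j; under eq_fun do rewrite gradvE//.
apply: measurable_mxdot => //; apply: mxmeas_dprodH => // l'.
by rewrite /single; case: (l' == l); exact: mxmeas_cst.
Qed.

End Entrywise.
End MatrixMeasurability.

(** * Fubini for an independent pair *)

Section IndependentPair.
Context d d1 d2 (R : realType) (Omega : measurableType d) (P : probability Omega R)
  (T1 : measurableType d1) (T2 : measurableType d2).
Variables (Y : Omega -> T1) (Z Z' : Omega -> T2).
Hypotheses (mY : measurable_fun setT Y) (mZ : measurable_fun setT Z)
  (mZ' : measurable_fun setT Z').
(** Taking [A] full shows that [Z'] has the law of [Z]; the hypothesis thus encodes independence of
    [Y] and [Z] together with equality of laws. *)
Hypothesis indep : forall A B, measurable A -> measurable B ->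
  P (Y @^-1` A `&` Z @^-1` B) = (P (Y @^-1` A) * P (Z' @^-1` B))%E.

Let Yf : {mfun Omega >-> T1} := HB.pack Y (isMeasurableFun.Build _ _ _ _ Y mY).
Let Zf' : {mfun Omega >-> T2} := HB.pack Z' (isMeasurableFun.Build _ _ _ _ Z' mZ').
Let mYZ : measurable_fun setT (fun w => (Y w, Z w)). Proof. exact: measurable_fun_pair. Qed.
Let YZf : {mfun Omega >-> (T1 * T2)%type} :=
  HB.pack (fun w => (Y w, Z w)) (isMeasurableFun.Build _ _ _ _ (fun w => (Y w, Z w)) mYZ).

Let joint_law A : measurable A ->
  (distribution P Yf \x distribution P Zf')%E A = distribution P YZf A.
Proof.
apply: product_measure_unique => B C mB mC.
rewrite /distribution /pushforward /= -indep//.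
Qed.

Local Open Scope ereal_scope.

Let law_integral (F : T1 * T2 -> \bar R) :
  \int[distribution P YZf]_p F p = \int[distribution P Yf \x distribution P Zf']_p F p.
Proof. by apply: eq_measure_integral => A mA _; exact/esym/joint_law. Qed.

Let ge0_law_le (F : T1 * T2 -> \bar R) (M : R) :
  measurable_fun setT F -> (forall p, 0 <= F p) ->
  (forall y, \int[P]_w' F (y, Z' w') <= M%:E) ->
  \int[distribution P Yf \x distribution P Zf']_p F p <= M%:E.
Proof.
move=> mF F0 FM; rewrite fubini_tonelli1//.
apply: (@le_trans _ _ (\int[distribution P Yf]_y (cst M%:E) y)).
  apply: ge0_le_integral => //.
  - by move=> y _; exact: integral_ge0.
  - exact: measurable_fun_fubini_tonelli_F.
  - move=> y _; rewrite /fubini_F ge0_integral_distribution//; first exact: FM.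
    exact: measurable_fun_pair2.
rewrite integral_cst// (_ : _ setT = 1) ?mule1//.
exact: (@probability_setT _ _ _ P).
Qed.

Lemma ge0_integral_indep_le (F : T1 * T2 -> \bar R) (M : R) :
  measurable_fun setT F -> (forall p, 0 <= F p) ->
  (forall y, \int[P]_w' F (y, Z' w') <= M%:E) ->
  \int[P]_w F (Y w, Z w) <= M%:E.
Proof.
move=> mF F0 FM; rewrite [X in X <= _](_ : _ = \int[distribution P YZf]_p F p); last first.
  by rewrite ge0_integral_distribution.
by rewrite law_integral; exact: ge0_law_le.
Qed.

(** The law of the pair is the product of the laws. The bound [M], uniform in [y], gives
    integrability for the product law by Tonelli, so that Fubini applies. *)
Lemma integral_indep (F : T1 * T2 -> \bar R) (M : R) :
  measurable_fun setT F -> (forall y, P.-integrable setT (fun w' => F (y, Z' w'))) ->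
  (forall y, \int[P]_w' `|F (y, Z' w')| <= M%:E) ->
  P.-integrable setT (fun w => F (Y w, Z w)) /\
  \int[P]_w F (Y w, Z w) = \int[P]_w \int[P]_w' F (Y w, Z' w').
Proof.
move=> mF iF FM.
have mA : measurable_fun setT (abse \o F) by exact: measurableT_comp.
have A0 p : 0 <= (abse \o F) p by exact: abse_ge0.
have iYZ : P.-integrable setT (fun w => F (Y w, Z w)).
  apply/integrableP; split; first exact: (measurableT_comp mF mYZ).
  exact: le_lt_trans (ge0_integral_indep_le mA A0 FM) (ltry _).
split=> //.
have iP : (distribution P Yf \x distribution P Zf').-integrable setT F.
  by apply/integrableP; split => //; exact: le_lt_trans (ge0_law_le mA A0 FM) (ltry _).
transitivity (\int[distribution P YZf]_p F p).
  by rewrite integral_distribution.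
rewrite law_integral -integral12_prod_meas1//.
have FE w : fubini_F (distribution P Zf') F (Y w) = \int[P]_w' F (Y w, Z' w').
  rewrite /fubini_F integral_distribution//; first exact: measurable_fun_pair2.
  exact: iF.
have mFF := measurable_fubini_F iP.
rewrite integral_distribution//=; first by apply: eq_integral => w _ /=; exact: FE.
apply/integrableP; split; first exact: measurableT_comp.
have /integrableP[_] := integrable_fubini_F iP.
by rewrite ge0_integral_distribution//; exact: measurableT_comp.
Qed.

End IndependentPair.

(** * The sigma-algebra of the past samples *)

Section Past.
Context d d' (R : realType) (Omega : measurableType d) (P : probability Omega R)
  (Xi : measurableType d').
Variable xi : nat -> Omega -> Xi.
Hypothesis mxi : forall k, measurable_fun setT (xi k).

(* The rectangles in the first [k] samples, a pi-system generating their sigma-algebra. *)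
Definition past k : set (set Omega) :=
  [set B | exists2 A : nat -> set Xi, (forall i, measurable (A i)) &
    B = \bigcap_(i in `I_k) (xi i @^-1` A i)].

(** The points of [Omega] with the coarser sigma-algebra, as a type: depending on the first [k]
    samples is then plain measurability on it. *)
Definition pastType k := g_sigma_algebraType (past k).

Lemma past_setI_closed k : setI_closed (past k).
Proof.
move=> _ _ [A mA ->] [B mB ->]; exists (fun i => A i `&` B i).
  by move=> i; exact: measurableI.
by rewrite -bigcapI; apply: eq_bigcapr => i _; rewrite preimage_setI.
Qed.

Let measurable_xi i A : measurable A -> measurable (xi i @^-1` A).
Proof. by move=> mA; rewrite -[X in measurable X]setTI; exact: mxi. Qed.

Lemma past_measurable k : past k `<=` measurable.
Proof.
move=> _ [A mA ->]; apply: bigcap_measurableType => i _; exact: measurable_xi.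
Qed.

Lemma measurable_id_past k : measurable_fun setT (fun w : Omega => w : pastType k).
Proof.
apply: (@measurability _ _ Omega (pastType k) setT _ (past k)) => // _ [B pB <-].
by rewrite setTI; exact: past_measurable pB.
Qed.

Lemma past_measurable_xi k i : (i < k)%N ->
  measurable_fun setT (xi i : pastType k -> Xi).
Proof.
move=> ik _ A mA; rewrite setTI; apply: sub_sigma_algebra.
exists (fun j => if j == i then A else setT) => [j|]; first by case: ifP.
apply/seteqP; split => [w Aw j _ /=|w /(_ i ik)/=]; last by rewrite eqxx.
by case: eqP => // ->.
Qed.

Lemma measurable_pastS k : measurable_fun setT (fun w : pastType k.+1 => w : pastType k).
Proof.
apply: (@measurability _ _ (pastType k.+1) (pastType k) setT _ (past k)) => // _ [B pB <-].
rewrite setTI; apply: sub_sigma_algebra; case: pB => A mA ->.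
(* The added slot [k] is left unconstrained. *)
exists (fun j => if j == k then setT else A j) => [j|]; first by case: ifP.
apply/seteqP; split => [w Aw j /= jk|w Aw j /= jk].
  by case: eqP => // /eqP jk'; apply: Aw => /=; rewrite ltn_neqAle jk' -ltnS.
by have /= := Aw j (ltnW jk); rewrite ltn_eqF.
Qed.

Hypothesis indep : mutually_independent P xi.
Local Open Scope ereal_scope.

(** Rectangles form a pi-system on which mutual independence gives the product formula; the sets
    satisfying it are closed under complements and disjoint countable unions. *)
Lemma past_indep k (B : set (pastType k)) (A : set Xi) : measurable B -> measurable A ->
  P (B `&` xi k @^-1` A) = P B * P (xi k @^-1` A).
Proof.
move=> mB mA; pose E := xi k @^-1` A.
have mE : measurable E by exact: measurable_xi.
have mO (C : set (pastType k)) : measurable C -> (measurable : set (set Omega)) C.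
  by move=> mC; have := @measurable_id_past k measurableT _ mC; rewrite setTI.
apply: (@dynkin_induction _ (pastType k) (past k)
  (fun C => P (C `&` E) = P C * P E)) => //.
- exact: past_setI_closed.
- by rewrite setTI probability_setT mul1e.
- move=> _ [C mC ->].
  have Ik : `I_k = [set` iota 0 k].
    by apply/seteqP; split => i /=; rewrite mem_iota add0n.
  rewrite Ik indep ?iota_uniq//.
  have nk : k \notin iota 0 k by rewrite mem_iota add0n ltnn.
  (* Independence for the indices below [k] was used just before; adding index [k] multiplies the
     product by the factor of [A]. *)
  have := indep (s := k :: iota 0 k) (A := fun i => if i == k then A else C i).
  rewrite /= nk iota_uniq big_cons eqxx => /(_ isT) h.
  rewrite muleC [X in _ = _ * X](_ : _ = \prod_(i <- iota 0 k)
      P (xi i @^-1` (if i == k then A else C i))); last first.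
    apply: eq_big_seq => i; rewrite mem_iota add0n /= => ik.
    by rewrite ltn_eqF.
  rewrite -h; last by move=> i _; case: ifP.
  congr (P _); apply/seteqP; split => w.
    move=> [Cw Ew] i /=; rewrite inE => /orP[/eqP ->|ik]; first by rewrite eqxx.
    by case: eqP => [->//|_]; exact: Cw.
  move=> Cw; split; last by have /= := Cw k; rewrite eqxx inE eqxx; apply.
  move=> i /= ik; have /= := Cw i; rewrite inE ik orbT => /(_ isT).
  by case: eqP => // ek; rewrite ek (negPf nk) in ik.
- move=> C /mO mC PC.
  have h : P E = P (E `\` C) + P (C `&` E).
    by rewrite (setIC C E); exact: (measureDI P).
  have -> : ~` C `&` E = E `\` C by rewrite setDE setIC.
  rewrite probability_setC//.
  move: h; rewrite PC.
  have fC : P C \is a fin_num by exact: fin_num_measure.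
  have fE : P E \is a fin_num by exact: fin_num_measure.
  have fD : P (E `\` C) \is a fin_num by apply: fin_num_measure; exact: measurableD.
  rewrite -(fineK fC) -(fineK fE) -(fineK fD) -!EFinM -!EFinD => -[h].
  by congr EFin; move: h; lra.
- move=> F mF tF PF; rewrite setI_bigcupl measure_bigcup//; last 2 first.
  + by move=> n _; apply: measurableI => //; exact: mO.
  + exact: trivIset_setIr.
  rewrite measure_bigcup//; last by move=> n _; exact: mO.
  have fE : P E \is a fin_num by exact: fin_num_measure.
  rewrite muleC -(fineK fE) -nneseriesZl//.
  by apply: eq_eseriesr => n _; rewrite fineK// [RHS]muleC; exact: PF.
Qed.

End Past.

(** * Convergence rate *)

Section Rate.
Variable R : realType.

(** With u = 1/(K+2), ln (1 - u) <= -u says that the new term is at most ln (K+2) - ln (K+1). *)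
Lemma harmonic_sum_le (K : nat) :
  \sum_(k < K.+1) (k.+1%:R^-1 : R) <= 1 + ln (K.+1%:R : R).
Proof.
elim: K => [|K IH]; first by rewrite big_ord1 ln1 addr0 invr1.
rewrite big_ord_recr /=; apply: (le_trans (lerD IH (lexx _))).
rewrite -addrA lerD2l -lerBrDl.
have K1 : (0 : R) < K.+1%:R by rewrite ltr0n.
have K2 : (0 : R) < K.+2%:R by rewrite ltr0n.
have := @le_ln1Dx R (- K.+2%:R^-1).
have -> : 1 - K.+2%:R^-1 = K.+1%:R / K.+2%:R :> R.
  have -> : K.+1%:R = K.+2%:R - 1 :> R by rewrite -[K.+2%:R]natr1 addrK.
  by rewrite mulrBl divff ?gt_eqF// mul1r.
rewrite lnM ?posrE ?invr_gt0// lnV ?posrE//.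
rewrite ltrN2 invf_lt1// ltr1n => /(_ isT).
by move: (K.+2%:R^-1) (ln K.+1%:R) (ln K.+2%:R) => u p q; lra.
Qed.

(** If every [b k] with k < K exceeded the threshold, the weighted sum would be at least delta K^eps
    = delta y^2 with y = K^(eps/2), whereas telescoping and ln K <= (2/eps) y bound it by M y. This
    fails once y > M / delta. *)
Lemma min_le_powR (a b : nat -> R) (B C : R) : 0 <= C ->
  (forall k, `|a k| <= B) ->
  (forall k, (Num.sqrt k.+1%:R)^-1 * b k <= a k - a k.+1 + k.+1%:R^-1 * C) ->
  forall eps, 0 < eps -> forall delta, 0 < delta ->
  exists K0 : nat, forall K : nat, (K0 <= K)%N ->
    exists2 k : nat, (k < K)%N & b k <= delta * K%:R `^ (eps - 2^-1).
Proof.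
move=> C0 aB step eps eps0 delta delta0.
have B0 : 0 <= B by apply: le_trans (aB 0%N).
have sum_le K : \sum_(k < K) (Num.sqrt k.+1%:R)^-1 * b k <=
    a 0%N - a K + C * \sum_(k < K) k.+1%:R^-1.
  elim: K => [|K IH]; first by rewrite !big_ord0 mulr0 subrr addr0.
  rewrite !big_ord_recr /= mulrDr; have := step K.
  by move: ((Num.sqrt _)^-1 * b K) (K.+1%:R^-1) => u p; lra.
(* Twice [B] for the telescoped ends, [C] for the constant of the harmonic sum, the rest for its
   logarithm. *)
pose M := B + B + C + C * (2 / eps).
have M0 : 0 <= M by rewrite !addr_ge0// mulr_ge0// divr_ge0// ltW.
pose Z := 1 + M / delta.
(* The summand 1 in [Z] forces y >= 1, so that constants are absorbed into multiples of [y]. *)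
have Z1 : 1 <= Z by rewrite lerDl divr_ge0// ltW.
exists (Num.truncn (Z `^ (2 / eps))).+1 => -[//|K] hK.
set k1 : R := K.+1%:R.
have k1_gt0 : 0 < k1 by rewrite ltr0n.
pose y := k1 `^ (eps / 2).
have yZ : Z < y.
  have ZE : Z = (Z `^ (2 / eps)) `^ (eps / 2).
    rewrite -powRrM (_ : 2 / eps * (eps / 2) = 1); last by field; rewrite gt_eqF.
    by rewrite powRr1// (le_trans ler01).
  rewrite [X in X < _]ZE; apply: gt0_ltr_powR.
  - by rewrite divr_gt0.
  - by rewrite nnegrE powR_ge0.
  - by rewrite nnegrE ltW.
  - apply: (lt_le_trans (truncnS_gt _)).
    by rewrite ler_nat.
apply: contrapT => hno.
have hb (k : 'I_K.+1) : delta * k1 `^ (eps - 2^-1) <= b k.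
  rewrite leNgt; apply/negP => h; apply: hno; exists k => //; exact: ltW.
have low : delta * (y * y) <= \sum_(k < K.+1) (Num.sqrt k.+1%:R)^-1 * b k.
  have -> : delta * (y * y) =
      \sum_(k < K.+1) (Num.sqrt k1)^-1 * (delta * k1 `^ (eps - 2^-1)).
    rewrite sumr_const card_ord -[RHS]mulr_natl -/k1 -powR12_sqrt ?(ltW k1_gt0)//.
    have kn0 : k1 != 0 by rewrite gt_eqF.
    have -> : y * y = k1 `^ 2^-1 * k1 `^ (eps - 2^-1).
      rewrite /y -!powRD ?kn0 ?implybT//; congr (_ `^ _).
      by field.
    have := powR_gt0 2^-1 k1_gt0; have : k1 = k1 `^ 2^-1 * k1 `^ 2^-1.
      by rewrite -powRD ?kn0 ?implybT// -[LHS](powRr1 (ltW k1_gt0)); congr (_ `^ _); field.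
    move: (k1 `^ 2^-1) => s ss s0; rewrite [X in _ = X * _]ss.
    by field; rewrite gt_eqF.
  apply: ler_sum => k _; apply: ler_pM => //.
  - by rewrite mulr_ge0 ?powR_ge0// ltW.
  - rewrite lef_pV2 ?posrE ?sqrtr_gt0 ?ltr0n// ler_wsqrtr// ler_nat.
    exact: ltn_ord.
have := le_trans low (sum_le K.+1).
have lny : ln k1 <= 2 / eps * y.
  have -> : ln k1 = 2 / eps * ln y by rewrite ln_powR; field; rewrite gt_eqF.
  rewrite ler_wpM2l ?divr_ge0 ?(ltW eps0)//.
  by apply/ltW/ln_sublinear; rewrite powR_gt0.
have hs := ler_wpM2l C0 (le_trans (harmonic_sum_le K) (lerD (lexx 1) lny)).
have a0 := aB 0%N; have aK := aB K.+1.
have y1 : 1 <= y by rewrite (le_trans Z1)// ltW.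
have yM : M < delta * y.
  have : M / delta < y by rewrite (lt_trans _ yZ)// ltrDr.
  by rewrite ltr_pdivrMr// mulrC.
have yyM : M * y < delta * (y * y) by rewrite mulrA ltr_pM2r// (lt_le_trans ltr01).
have e1 : M * y = (B + B + C) * y + C * (2 / eps * y) by rewrite /M; ring.
have e2 : B + B + C <= (B + B + C) * y by rewrite ler_peMr// !addr_ge0.
have := le_trans (ler_norm _) a0.
have := le_trans (ler_norm _) (_ : `|- a K.+1| <= B); rewrite normrN => /(_ aK).
by move: hs; rewrite mulrDr mulr1; lra.
Qed.

End Rate.

(** * Expected descent of the stochastic iteration *)

Lemma Rintegral_descent d (T : measurableType d) (R : realType) (mu : {measure set T -> \bar R})
    (X Y F F' : T -> R) (eta c b m : R) : 0 <= c ->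
  mu.-integrable setT (EFin \o X) -> mu.-integrable setT (EFin \o Y) ->
  mu.-integrable setT (EFin \o F) -> mu.-integrable setT (EFin \o F') ->
  (forall w, F' w - F w <= - (eta * X w) + c * Y w) ->
  (\int[mu]_w (X w)%:E = b%:E)%E -> (\int[mu]_w (Y w)%:E <= m%:E)%E ->
  eta * b <= Rintegral mu setT F - Rintegral mu setT F' + c * m.
Proof.
move=> c0 iX iY iF iF' step Xb Ym.
have -> : b = Rintegral mu setT X by rewrite /Rintegral Xb.
have RYm : Rintegral mu setT Y <= m.
  by rewrite -lee_fin /Rintegral fineK//; exact: integrable_fin_num.
have iFF : mu.-integrable setT (EFin \o (fun w => F w - F' w)).
  exact: (integrableB measurableT iF iF').
have icY : mu.-integrable setT (EFin \o (fun w => c * Y w)).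
  exact: (integrableZl measurableT c iY).
rewrite -RintegralZl//.
apply: (@le_trans _ _ (Rintegral mu setT (fun w => (F w - F' w) + c * Y w))).
  apply: le_Rintegral => //.
  - exact: (integrableZl measurableT eta iX).
  - exact: (integrableD measurableT iFF icY).
  - by move=> w _; have := step w; lra.
by rewrite RintegralD// RintegralB// RintegralZl// lerD2l ler_wpM2l.
Qed.

Section SGD.
Context (R : realType) (N L : nat) (f : 'M[R]_N -> R) (M1 M2 : R)
  (d d' : measure_display) (Omega : measurableType d) (P : probability Omega R)
  (Xi : measurableType d') (ft : Xi -> 'M[R]_N -> R) (xi : nat -> Omega -> Xi)
  (v0 : 'I_L -> 'cV[R]_N).
Hypotheses (df : forall X, differentiable f X) (M1_gt0 : 0 < M1)
  (lipf : forall X' X'', mxO X' -> mxO X'' ->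
     frob (grad f X' - grad f X'') <= M1 * frob (X' - X''))
  (dft : forall z X, differentiable (ft z) X)
  (mft : forall i j, measurable_fun setT
     (fun p : (Xi * mxBorel R N N)%type => grad (ft p.1) p.2 i j))
  (mxi : forall k, measurable_fun setT (xi k))
  (indep : mutually_independent P xi)
  (idd : forall k A, measurable A -> P (xi k @^-1` A) = P (xi 0%N @^-1` A))
  (unbiased : forall X, mxO X -> forall i j,
     P.-integrable setT (fun w => (grad (ft (xi 0%N w)) X i j)%:E) /\
     (\int[P]_w (grad (ft (xi 0%N w)) X i j)%:E = (grad f X i j)%:E)%E)
  (M2_gt0 : 0 < M2)
  (second_moment : forall X, mxO X ->
     (\int[P]_w (frob2 (grad (ft (xi 0%N w)) X))%:E <= M2%:E)%E)
  (v0_neq0 : forall l, v0 l != 0).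

Let v k w := iterate (fun k => ft (xi k w)) v0 k.
Let Q k w := prodH (v k w).
(** Determined by the first [k] samples. Paired with the sampled gradient at [Q k w] it gives the
    cross term, paired with [grad f] there the squared norm of all the [gradv f]. *)
Let U k w := dprodH (v k w) (gradv f (v k w)).

Lemma sgd_neq0 k w l : v k w l != 0.
Proof.
have [h _] := @iterate_frob_ge R N L (fun k => ft (xi k w)) v0 (fun _ => dft _) v0_neq0 k.
exact: h.
Qed.

Let QO k w : mxO (Q k w).
Proof. by apply: mxO_prodH => l; exact: sgd_neq0. Qed.

Let mQ_of d1 (T : measurableType d1) (vs : T -> 'I_L -> 'cV[R]_N) :
  (forall l, mxmeas (vs ^~ l)) ->
  measurable_fun setT ((fun w => prodH (vs w)) : T -> mxBorel R N N).
Proof. by move=> mvs; apply: measurable_fun_mxBorel; exact: mxmeas_prodH. Qed.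

Let mgrad_comp d1 (T : measurableType d1) (z : T -> Xi) (X : T -> 'M[R]_N) :
  measurable_fun setT z -> measurable_fun setT (X : T -> mxBorel R N N) ->
  mxmeas (fun w => grad (ft (z w)) (X w)).
Proof.
move=> mz mX i j; have mzX := measurable_fun_pair mz mX.
exact: (measurableT_comp (mft i j) mzX).
Qed.

(** Iterate [k] involves only samples of index below [k], hence is measurable for the coarser
    structure; its independence from [xi k] rests on this. *)
Let mv k l : mxmeas (fun w : pastType xi k => v k w l).
Proof.
elim: k l => [|k IH] l; first exact: mxmeas_cst.
have mvk l' : mxmeas (fun w : pastType xi k.+1 => v k w l').
  by move=> i j; exact: (measurableT_comp (IH l' i j) (@measurable_pastS _ _ _ _ xi k)).
apply: mxmeasB; first exact: mvk.
apply: mxmeasZ; first exact: measurable_cst.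
apply: (@mxmeas_gradv _ _ (pastType xi k.+1) _ _ (fun w => ft (xi k w)) (v k)) => //.
- by move=> w l'; exact: sgd_neq0.
- by apply: mgrad_comp; [exact: past_measurable_xi|exact: mQ_of].
Qed.

Let mQ k : measurable_fun setT (Q k : pastType xi k -> mxBorel R N N).
Proof. exact: mQ_of. Qed.

Let to_Omega k d1 (T : measurableType d1) (F : pastType xi k -> T) :
  measurable_fun setT F -> measurable_fun [set: Omega] (fun w : Omega => F w).
Proof. by move=> mF; exact: (measurableT_comp mF (measurable_id_past mxi (k:=k))). Qed.

Let mgradf k : mxmeas (fun w : pastType xi k => grad f (Q k w)).
Proof. by move=> i j; exact: (measurableT_comp (@measurable_grad R N N f i j df) (@mQ k)). Qed.

Let mgradvf k l : mxmeas (fun w : pastType xi k => gradv f (v k w) l).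
Proof.
apply: (@mxmeas_gradv _ _ (pastType xi k) _ _ (fun=> f) (v k)) => //.
by move=> w l'; exact: sgd_neq0.
Qed.

Let mU k : mxmeas (fun w : pastType xi k => U k w).
Proof. by apply: mxmeas_dprodH. Qed.

Let mgradft k : mxmeas (fun p : (pastType xi k * Xi)%type => grad (ft p.2) (Q k p.1)).
Proof.
by apply: mgrad_comp => //; exact: (measurableT_comp (@mQ k)).
Qed.

(** A positive lower bound for all initial lengths that also makes sense when [L] is 0. *)
Let c := (1 + \sum_l (frob (v0 l))^-1)^-1.

Let c_gt0 : 0 < c.
Proof. by rewrite invr_gt0 ltr_pwDl// sumr_ge0// => l _; rewrite invr_ge0 frob_ge0. Qed.

Let c_le k w l : c <= frob (v k w l).
Proof.
have [_ /(_ l)] := @iterate_frob_ge R N L (fun k => ft (xi k w)) v0 (fun _ => dft _) v0_neq0 k.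
apply: le_trans; rewrite -[frob (v0 l)]invrK lef_pV2 ?posrE ?invr_gt0 ?frob_gt0//.
  rewrite (bigD1 l)//= addrCA lerDl addr_ge0// sumr_ge0// => l' _.
  by rewrite invr_ge0 frob_ge0.
by rewrite -invr_gt0 c_gt0.
Qed.

Let G := frob (grad f 1%:M) + M1 * (2 * frob (1%:M : 'M[R]_N)).

Let G_le X : mxO X -> frob (grad f X) <= G.
Proof. by apply: frob_grad_bound => //; exact: ltW. Qed.

Let B_U := 8 * L%:R * (8 * L%:R / c * G / c).

Let U_le k w : frob (U k w) <= B_U.
Proof.
have := @frob_dprodHs_le R N L (v k w) (gradv f (v k w)) (enum 'I_L)
  (8 * L%:R / c * G / c) (fun l => sgd_neq0 k w l).
rewrite size_enum_ord; apply=> l.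
apply: ler_pM; rewrite ?invr_ge0 ?frob_ge0//; last first.
  by rewrite lef_pV2 ?posrE ?frob_gt0 ?sgd_neq0 ?c_gt0 ?c_le.
apply: (le_trans (frob_gradv_le l df c_gt0 (fun l => c_le k w l))).
apply: ler_wpM2l; last exact/G_le/QO.
by apply: divr_ge0; [exact: mulr_ge0|exact: ltW].
Qed.

(** Instance of the pair setting: [Y] is the identity into [pastType xi k], and the copy [Z'] is
    [xi 0], for which the moment hypotheses are stated. *)
Let past_indep0 k (A : set (pastType xi k)) (B : set Xi) : measurable A -> measurable B ->
  P ((fun w : Omega => w : pastType xi k) @^-1` A `&` xi k @^-1` B) =
  (P ((fun w : Omega => w : pastType xi k) @^-1` A) * P (xi 0%N @^-1` B))%E.
Proof. by move=> mA mB; rewrite -(idd k mB) -past_indep. Qed.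

Let mft0 X : mxmeas (fun w => grad (ft (xi 0%N w)) X).
Proof. by apply: mgrad_comp => //; exact: measurable_cst. Qed.

Let moment2 k : (\int[P]_w (frob2 (grad (ft (xi k w)) (Q k w)))%:E <= M2%:E)%E.
Proof.
apply: (ge0_integral_indep_le (measurable_id_past mxi (k:=k)) (mxi k) (mxi 0) (@past_indep0 k)
  (F := fun p => (frob2 (grad (ft p.2) (Q k p.1)))%:E)).
- by apply/measurable_EFinP; exact: measurable_frob2.
- by move=> p; rewrite lee_fin frob2_ge0.
- by move=> w; exact: (second_moment (QO k w)).
Qed.

Let mgradft_Omega k : mxmeas (fun w : Omega => grad (ft (xi k w)) (Q k w)).
Proof.
by apply: mgrad_comp => //; exact: (to_Omega (@mQ k)).
Qed.

Let integrable_moment2 k :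
  P.-integrable setT (EFin \o (fun w => frob2 (grad (ft (xi k w)) (Q k w)))).
Proof.
apply/integrableP; split; first by apply/measurable_EFinP; exact: measurable_frob2.
rewrite (le_lt_trans _ (ltry M2))// (le_trans _ (moment2 k))//.
apply: ge0_le_integral => //.
- by apply/measurable_EFinP; apply: measurableT_comp => //; exact: measurable_frob2.
- by apply/measurable_EFinP; exact: measurable_frob2.
- by move=> w _; rewrite /= lee_fin ger0_norm// frob2_ge0.
Qed.

Let bounded_integrable (F : Omega -> R) (B : R) :
  measurable_fun setT F -> (forall w, `|F w| <= B) -> P.-integrable setT (EFin \o F).
Proof.
move=> mF FB; apply: (@le_integrable _ _ _ P setT measurableT (EFin \o F) (EFin \o cst B)).
- exact/measurable_EFinP.
- by move=> w _; rewrite /= lee_fin (le_trans (FB w))// ler_norm.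
- exact: finite_measure_integrable_cst.
Qed.

Let integrable_mxdot X W : mxO X ->
  P.-integrable setT (fun w => (mxdot (grad (ft (xi 0%N w)) X) W)%:E) /\
  (\int[P]_w (mxdot (grad (ft (xi 0%N w)) X) W)%:E = (mxdot (grad f X) W)%:E)%E.
Proof.
move=> XO.
have E w : (mxdot (grad (ft (xi 0%N w)) X) W)%:E =
   (\sum_(p : 'I_N * 'I_N) (grad (ft (xi 0%N w)) X p.1 p.2)%:E * (W p.1 p.2)%:E)%E.
  by rewrite /mxdot pair_bigA /= -sumEFin.
have i1 (p : 'I_N * 'I_N) : P.-integrable setT
    (fun w => (grad (ft (xi 0%N w)) X p.1 p.2)%:E * (W p.1 p.2)%:E)%E.
  by apply: integrableZr => //; exact: (unbiased XO p.1 p.2).1.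
split; first by under eq_fun do rewrite E; exact: integrable_sum.
under eq_integral do rewrite E; rewrite integral_sum//.
rewrite /mxdot pair_bigA /= -sumEFin; apply: eq_bigr => p _.
by rewrite integralZr// ?(unbiased XO p.1 p.2).2//; exact: (unbiased XO p.1 p.2).1.
Qed.

Let mean_sq k := Rintegral P setT (fun w => mxdot (grad f (Q k w)) (U k w)).

Let mean_sq_fin k :
  (\int[P]_w (mxdot (grad f (Q k w)) (U k w))%:E = (mean_sq k)%:E)%E.
Proof.
rewrite /mean_sq /Rintegral fineK//; apply: integrable_fin_num => //.
apply: (@bounded_integrable _ (G * B_U)).
  by apply: measurable_mxdot => i j; [exact: (to_Omega (@mgradf k i j))|exact: (to_Omega (@mU k i j))].
by move=> w; rewrite (le_trans (normr_mxdot_le _ _))// ler_pM ?frob_ge0 ?U_le ?G_le.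
Qed.

(** With the past frozen, [Q k] and [U k] are constants, and unbiasedness replaces the sampled
    gradient by [grad f]. *)
Let cross k : P.-integrable setT
    (fun w => (mxdot (grad (ft (xi k w)) (Q k w)) (U k w))%:E) /\
  (\int[P]_w (mxdot (grad (ft (xi k w)) (Q k w)) (U k w))%:E = (mean_sq k)%:E)%E.
Proof.
have mF : measurable_fun setT (fun p : (pastType xi k * Xi)%type =>
    (mxdot (grad (ft p.2) (Q k p.1)) (U k p.1))%:E).
  apply/measurable_EFinP; apply: measurable_mxdot => // i j.
  exact: (measurableT_comp (@mU k i j)).
(* The constant comes from |<A, U>| <= |A| [B_U] and |A| <= 1 + |A|^2, which turns the second moment
   into a first-moment bound. *)
have [|y|i1 e] := integral_indep (measurable_id_past mxi (k:=k)) (mxi k) (mxi 0)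
  (@past_indep0 k) (M := (1 + M2) * B_U) mF.
- by move=> w; have [] := integrable_mxdot (U k w) (QO k w).
- have BU0 : 0 <= B_U by apply: le_trans (U_le k y); exact: frob_ge0.
  have mD := measurable_mxdot (@mft0 (Q k y)) (@mxmeas_cst R _ Omega _ _ (U k y)).
  have mF2 := measurable_frob2 (@mft0 (Q k y)).
  apply: (@le_trans _ _
      (\int[P]_w' ((1 + frob2 (grad (ft (xi 0%N w')) (Q k y))) * B_U)%:E)%E).
    apply: ge0_le_integral => //.
    + by apply/measurable_EFinP; apply: measurableT_comp => //; exact: mD.
    + by apply/measurable_EFinP; apply: measurable_funM => //; apply: measurable_funD.
    + move=> w' _; rewrite /= lee_fin (le_trans (normr_mxdot_le _ _))//.
      rewrite ler_pM ?frob_ge0 ?U_le// -sqr_frob.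
      by have := sqr_ge0 (frob (grad (ft (xi 0%N w')) (Q k y)) - 1); nra.
  under eq_integral do rewrite EFinM EFinD muleC.
  rewrite ge0_integralZl//; last 2 first.
  + by apply: emeasurable_funD => //; exact/measurable_EFinP.
  + by move=> w' _; rewrite adde_ge0// lee_fin ?ler01 ?frob2_ge0.
  rewrite muleC [((1 + M2) * B_U)%:E]EFinM lee_wpmul2r ?lee_fin// ge0_integralD//; last 2 first.
  + by move=> w' _; rewrite lee_fin frob2_ge0.
  + by apply/measurable_EFinP; exact: mF2.
  rewrite [(1 + M2)%:E]EFinD; apply: leeD; last exact: (second_moment (QO k y)).
  rewrite (integral_cst P measurableT 1%E) (_ : _ setT = 1%E) ?mule1//.
  exact: probability_setT.
- split; first exact: i1.
  apply: (etrans e); rewrite -mean_sq_fin; apply: eq_integral => w _.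
  exact: (integrable_mxdot (U k w) (QO k w)).2.
Qed.

(** Adjointness applied to [f] in the direction of its own [gradv]. *)
Let mean_sqE k : (\sum_(l < L) \int[P]_w (frob2 (gradv f (v k w) l))%:E)%E = (mean_sq k)%:E.
Proof.
rewrite -ge0_integral_sum//; last 2 first.
- move=> l; apply/measurable_EFinP; apply: measurable_frob2 => i j.
  exact: (to_Omega (@mgradvf k l i j)).
- by move=> l w _; rewrite lee_fin frob2_ge0.
rewrite -mean_sq_fin; apply: eq_integral => w _; rewrite sumEFin; congr EFin.
rewrite -mxdot_gradv_sum => [|//|l]; last exact: sgd_neq0.
by apply: eq_bigr => l _; rewrite mxdotxx.
Qed.

(** A finite minimum is below a bound when some index is, hence the existential in [k]; [delta]
    spells out the little-o. [min_le_powR] is applied to the means of [f (Q k)] and to [mean_sq]. *)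
Lemma sgd_rate eps : 0 < eps -> forall delta, 0 < delta ->
  exists K0 : nat, forall K : nat, (K0 <= K)%N ->
    exists2 k : nat, (k < K)%N &
      (\sum_(l < L) \int[P]_w (frob2 (gradv f (v k w) l))%:E
       <= (delta * K%:R `^ (eps - 2^-1))%:E)%E.
Proof.
move=> eps0 delta delta0.
have [B fB] := mxO_bounded df.
have [C C0 descent] := gradv_step_descent L df (ltW M1_gt0) lipf G_le c_gt0.
have cf : continuous f by move=> X; exact: differentiable_continuous.
have mfQ k : measurable_fun setT (fun w => f (Q k w)).
  exact: (to_Omega (measurableT_comp (continuous_measurable_mxBorel cf) (@mQ k))).
have ifQ k : P.-integrable setT (EFin \o (fun w => f (Q k w))).
  by apply: (bounded_integrable (mfQ k) (B := B)) => w; exact/fB/QO.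
pose a k := Rintegral P setT (fun w => f (Q k w)).
have aB k : `|a k| <= B.
  apply: (le_trans (le_normr_Rintegral _ _)) => //.
  have -> : B = Rintegral P setT (cst B).
    by rewrite Rintegral_cst// (_ : _ setT = 1%E) ?mulr1//; exact: probability_setT.
  apply: le_Rintegral => //.
  - apply: (@bounded_integrable _ B); first exact: measurableT_comp.
    by move=> w; rewrite normr_id; exact/fB/QO.
  - exact: finite_measure_integrable_cst.
  - by move=> w _; exact/fB/QO.
have step k : (Num.sqrt k.+1%:R)^-1 * mean_sq k <= a k - a k.+1 + k.+1%:R^-1 * (C * M2).
  set eta : R := (Num.sqrt k.+1%:R)^-1.
  have eta0 : 0 <= eta by rewrite invr_ge0 sqrtr_ge0.
  have etaE : eta ^+ 2 = k.+1%:R^-1 by rewrite exprVn sqr_sqrtr.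
  have [iX EX] := cross k.
  rewrite mulrA -etaE; apply: (@Rintegral_descent _ _ _ P
    (fun w => mxdot (grad (ft (xi k w)) (Q k w)) (U k w))
    (fun w => frob2 (grad (ft (xi k w)) (Q k w)))
    (fun w => f (Q k w)) (fun w => f (Q k.+1 w))).
  - by rewrite mulr_ge0 ?sqr_ge0.
  - exact: iX.
  - exact: integrable_moment2.
  - exact: ifQ.
  - exact: ifQ.
  - by move=> w; rewrite -mulrA; exact: (descent _ _ eta (dft (xi k w)) (c_le k w) eta0).
  - exact: EX.
  - exact: moment2.
have [K0 hK0] := min_le_powR (mulr_ge0 C0 (ltW M2_gt0)) aB step eps0 delta0.
by exists K0 => K /hK0[k kK bk]; exists k => //; rewrite mean_sqE lee_fin.
Qed.

End SGD.

Theorem theorem4 (R : realType) (N L : nat) (f : 'M[R]_N -> R) (M1 M2 : R)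
  (d d' : measure_display) (Omega : measurableType d) (P : probability Omega R)
  (Xi : measurableType d') (ft : Xi -> 'M[R]_N -> R) (xi : nat -> Omega -> Xi)
  (v0 : 'I_L -> 'cV[R]_N) :
  (forall X, differentiable f X) ->
  0 < M1 ->
  (forall X' X'', mxO X' -> mxO X'' ->
     frob (grad f X' - grad f X'') <= M1 * frob (X' - X'')) ->
  (forall z X, differentiable (ft z) X) ->
  (forall i j, measurable_fun setT
     (fun p : (Xi * mxBorel R N N)%type => grad (ft p.1) p.2 i j)) ->
  (forall k, measurable_fun setT (xi k)) ->
  mutually_independent P xi ->
  (forall k A, measurable A -> P (xi k @^-1` A) = P (xi 0%N @^-1` A)) ->
  (forall X, mxO X -> forall i j,
     P.-integrable setT (fun w => (grad (ft (xi 0%N w)) X i j)%:E) /\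
     (\int[P]_w (grad (ft (xi 0%N w)) X i j)%:E = (grad f X i j)%:E)%E) ->
  0 < M2 ->
  (forall X, mxO X ->
     (\int[P]_w (frob2 (grad (ft (xi 0%N w)) X))%:E <= M2%:E)%E) ->
  (forall l, v0 l != 0) ->
  (forall k w l, iterate (fun k => ft (xi k w)) v0 k l != 0) /\
  (forall eps, 0 < eps -> forall delta, 0 < delta ->
     exists K0 : nat, forall K : nat, (K0 <= K)%N ->
       exists2 k : nat, (k < K)%N &
         (\sum_(l < L) \int[P]_w
             (frob2 (gradv f (iterate (fun k => ft (xi k w)) v0 k) l))%:E
          <= (delta * K%:R `^ (eps - 2^-1))%:E)%E).
Proof.
move=> df M10 lipf dft mft mxi indep idd unb M20 mom v00.
split; first by move=> k w l; exact: (sgd_neq0 xi dft v00).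
move=> eps eps0 delta delta0.
exact: (sgd_rate df M10 lipf dft mft mxi indep idd unb M20 mom v00 eps0 delta0).
Qed.
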